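(* Consider the linear system $x^+=Ax+Bu$, $y=Cx+Du$, with $x\in\mathbb{R}^n$, $u\in\mathbb{R}^m$, $y\in\mathbb{R}^p$, subject to the constraints $(x(k),u(k))\in\mathcal{Z}$ for all $k\ge 0$, where $\mathcal{Z}\subset\mathbb{R}^{n+m}$ is a closed convex polyhedron with nonempty interior containing the origin and $\{u:\exists x,\,(x,u)\in\mathcal{Z}\}$ is compact. Assume: (a) the pair $(A,B)$ is stabilizable and the state is measured at each sampling time; (b) the offset cost $V_O:\mathbb{R}^p\times\mathbb{R}^p\to\mathbb{R}$ is convex, positive definite and subdifferentiable, with $V_O(0,0)=0$, and such that the minimizer of $\min_{y\in\mathcal{Y}_{sp}}V_O(y,y_{sp})$ is unique; (c) the pair $(A,B)$ is controllable, $n_c\ge1$ is the minimal integer such that $[A^{n_c-1}B,\ A^{n_c-2}B,\ \dots,\ B]$ is full rank, $R\in\mathbb{R}^{m\times m}$ is positive definite, and $Q\in\mathbb{R}^{n\times n}$ is positive semidefinite with $(Q^{1/2},A)$ observable; (d) the prediction horizon satisfies $N\ge n_c$. Then, for a given setpoint $y_{sp}\in\mathbb{R}^p$ and any initial state $x_0\in\mathcal{X}_N$, the closed-loop system $x(k+1)=Ax(k)+B\kappa_N(x(k),y_{sp})$, $x(0)=x_0$, is stable and fulfills the constraints $(x(k),\kappa_N(x(k),y_{sp}))\in\mathcal{Z}$ for all $k\ge0$; moreover: (i) if $y_{sp}\in\mathcal{Y}_{sp}$, then the closed-loop system asymptotically converges to the steady state, input and output $(x_{sp},u_{sp},y_{sp})$;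 (ii) if $y_{sp}\notin\mathcal{Y}_{sp}$, then the closed-loop system asymptotically converges to a reachable steady state, input and output $(x_t,u_t,y_t)$ with $y_t=\arg\min_{y\in\mathcal{Y}_{sp}}V_O(y,y_{sp})$.
   Context: A constant $\lambda\in[0,1)$ (arbitrarily close to 1) is fixed. The set of reachable setpoints is $\mathcal{Y}_{sp}=\{Cx_s+Du_s:\ x_s=Ax_s+Bu_s,\ (x_s,u_s)\in\lambda\mathcal{Z}\}$ and the set of reachable steady states is $\mathcal{X}_{sp}=\{x_s:\exists u_s,\ x_s=Ax_s+Bu_s,\ (x_s,u_s)\in\lambda\mathcal{Z}\}$. For $Q,R$ and $\|z\|_M^2=z^\top Mz$, the MPC for tracking with terminal equality constraint solves, for the parameters $(x,y_{sp})$, $V_N^0(x,y_{sp})=\min_{\mathbf{u},x_a,u_a}\sum_{j=0}^{N-1}\big(\|x(j)-x_a\|_Q^2+\|u(j)-u_a\|_R^2\big)+V_O(y_a,y_{sp})$ subject to $x(0)=x$, $x(j+1)=Ax(j)+Bu(j)$, $(x(j),u(j))\in\mathcal{Z}$ for $j=0,\dots,N-1$, $x_a=Ax_a+Bu_a$, $y_a=Cx_a+Du_a$, $(x_a,u_a)\in\lambda\mathcal{Z}$, $x(N)=x_a$, where $\mathbf{u}=(u(0),\dots,u(N-1))$. $\mathcal{X}_N$ denotes the set of states $x$ for which this problem is feasible (it does not depend on $y_{sp}$). The control law is $\kappa_N(x,y_{sp})=u^0(0;x,y_{sp})$, the first element of the optimal input sequence. When $y_{sp}\in\mathcal{Y}_{sp}$,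 $(x_{sp},u_{sp})$ denotes the admissible equilibrium with output $y_{sp}$.
   Formalization: ''Positive definite'' is taken to mean V_O(y,y_sp) ≥ 0 with equality iff y = y_sp (the joint reading makes (i) false), and it is assumed that an admissible equilibrium in λZ is determined by its output, so that ''the'' equilibrium (x_sp,u_sp) is well defined. *)

(* Defs.v *)
From HB Require Import structures.
From mathcomp Require Import all_boot all_order all_algebra.
From mathcomp Require Import all_classical all_reals all_analysis.
Set Implicit Arguments. Unset Strict Implicit. Unset Printing Implicit Defensive.
Import Order.TTheory GRing.Theory Num.Theory.
Import numFieldNormedType.Exports.
Local Open Scope ring_scope.
Local Open Scope classical_set_scope.

Section MPC.
Variable R : realType.

Definition qform (k : nat) (M : 'M[R]_k) (v : 'cV[R]_k) : R := (v^T *m M *m v) 0 0.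

Definition posdef_mx (k : nat) (M : 'M[R]_k) : Prop :=
  forall v : 'cV[R]_k, v != 0 -> 0 < qform M v.
Definition possemidef_mx (k : nat) (M : 'M[R]_k) : Prop :=
  forall v : 'cV[R]_k, 0 <= qform M v.

Variables (n m p : nat).

Definition ctrb_mx (A : 'M[R]_n) (B : 'M[R]_(n, m)) (k : nat) :=
  \mxrow_(j < k) (A ^+ (k.-1 - j) *m B).

Definition controllable (A : 'M[R]_n) (B : 'M[R]_(n, m)) : Prop :=
  \rank (ctrb_mx A B n) = n.

Definition observable (k : nat) (S : 'M[R]_(k, n)) (A : 'M[R]_n) : Prop :=
  \rank (\mxcol_(j < n) (S *m A ^+ j)) = n.

(* (A,B) stabilizable: some linear state feedback u = K x makes the
   closed loop x+ = (A + B K) x asymptotically stable (its powers vanish). *)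
Definition stabilizable (A : 'M[R]_n) (B : 'M[R]_(n, m)) : Prop :=
  exists K : 'M[R]_(m, n), (fun k : nat => (A + B *m K) ^+ k) @ \oo --> (0 : 'M[R]_n).

Definition inZ (q : nat) (G : 'M[R]_(q, n + m)) (g : 'cV[R]_q)
  (x : 'cV[R]_n) (u : 'cV[R]_m) : Prop :=
  forall i, (G *m col_mx x u) i 0 <= g i 0.

Definition Zset (q : nat) (G : 'M[R]_(q, n + m)) (g : 'cV[R]_q) : set 'cV[R]_(n + m) :=
  [set z | forall i, (G *m z) i 0 <= g i 0].

Definition inlamZ (q : nat) (G : 'M[R]_(q, n + m)) (g : 'cV[R]_q) (lam : R)
  (x : 'cV[R]_n) (u : 'cV[R]_m) : Prop :=
  exists (x' : 'cV[R]_n) (u' : 'cV[R]_m),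
    inZ G g x' u' /\ x = lam *: x' /\ u = lam *: u'.

Definition adm_eq (A : 'M[R]_n) (B : 'M[R]_(n, m)) (q : nat) (G : 'M[R]_(q, n + m))
  (g : 'cV[R]_q) (lam : R) (xs : 'cV[R]_n) (us : 'cV[R]_m) : Prop :=
  xs = A *m xs + B *m us /\ inlamZ G g lam xs us.

Definition Ysp (A : 'M[R]_n) (B : 'M[R]_(n, m)) (C : 'M[R]_(p, n)) (D : 'M[R]_(p, m))
  (q : nat) (G : 'M[R]_(q, n + m)) (g : 'cV[R]_q) (lam : R) : set 'cV[R]_p :=
  [set y | exists xs us, adm_eq A B G g lam xs us /\ y = C *m xs + D *m us].

Fixpoint xpred (A : 'M[R]_n) (B : 'M[R]_(n, m)) (x : 'cV[R]_n)
  (u : nat -> 'cV[R]_m) (j : nat) : 'cV[R]_n :=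
  match j with
  | 0 => x
  | j'.+1 => A *m xpred A B x u j' + B *m u j'
  end.

Section OCP.
Variables (A : 'M[R]_n) (B : 'M[R]_(n, m)) (C : 'M[R]_(p, n)) (D : 'M[R]_(p, m))
  (q : nat) (G : 'M[R]_(q, n + m)) (g : 'cV[R]_q) (lam : R)
  (Q : 'M[R]_n) (Rw : 'M[R]_m) (VO : 'cV[R]_p -> 'cV[R]_p -> R) (N : nat).

Definition mpc_feasible (x : 'cV[R]_n) (u : nat -> 'cV[R]_m)
  (xa : 'cV[R]_n) (ua : 'cV[R]_m) : Prop :=
  (forall j, (j < N)%N -> inZ G g (xpred A B x u j) (u j)) /\
  adm_eq A B G g lam xa ua /\
  xpred A B x u N = xa.

Definition mpc_cost (x : 'cV[R]_n) (ysp : 'cV[R]_p) (u : nat -> 'cV[R]_m)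
  (xa : 'cV[R]_n) (ua : 'cV[R]_m) : R :=
  \sum_(j < N) (qform Q (xpred A B x u j - xa) + qform Rw (u j - ua))
  + VO (C *m xa + D *m ua) ysp.

Definition XN : set 'cV[R]_n :=
  [set x | exists u xa ua, mpc_feasible x u xa ua].

Definition mpc_optimal (x : 'cV[R]_n) (ysp : 'cV[R]_p) (u : nat -> 'cV[R]_m)
  (xa : 'cV[R]_n) (ua : 'cV[R]_m) : Prop :=
  mpc_feasible x u xa ua /\
  forall u' xa' ua', mpc_feasible x u' xa' ua' ->
    mpc_cost x ysp u xa ua <= mpc_cost x ysp u' xa' ua'.

Definition is_mpc_law (ysp : 'cV[R]_p) (kappa : 'cV[R]_n -> 'cV[R]_m) : Prop :=
  forall x, XN x -> exists u xa ua, mpc_optimal x ysp u xa ua /\ u 0%N = kappa x.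

End OCP.

Fixpoint cl_traj (A : 'M[R]_n) (B : 'M[R]_(n, m)) (kappa : 'cV[R]_n -> 'cV[R]_m)
  (x0 : 'cV[R]_n) (k : nat) : 'cV[R]_n :=
  match k with
  | 0 => x0
  | k'.+1 => A *m cl_traj A B kappa x0 k' + B *m kappa (cl_traj A B kappa x0 k')
  end.

Definition cl_stable (A : 'M[R]_n) (B : 'M[R]_(n, m)) (kappa : 'cV[R]_n -> 'cV[R]_m)
  (X : set 'cV[R]_n) (xt : 'cV[R]_n) : Prop :=
  forall eps : R, 0 < eps -> exists delta : R, 0 < delta /\
    forall x0, X x0 -> `|x0 - xt| < delta ->
      forall k, `|cl_traj A B kappa x0 k - xt| < eps.

Definition cl_converges (A : 'M[R]_n) (B : 'M[R]_(n, m)) (C : 'M[R]_(p, n))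
  (D : 'M[R]_(p, m)) (kappa : 'cV[R]_n -> 'cV[R]_m) (x0 : 'cV[R]_n)
  (xt : 'cV[R]_n) (ut : 'cV[R]_m) (yt : 'cV[R]_p) : Prop :=
  (fun k => cl_traj A B kappa x0 k) @ \oo --> xt /\
  (fun k => kappa (cl_traj A B kappa x0 k)) @ \oo --> ut /\
  (fun k => C *m cl_traj A B kappa x0 k + D *m kappa (cl_traj A B kappa x0 k)) @ \oo --> yt.

Definition is_argmin_VO (Y : set 'cV[R]_p) (VO : 'cV[R]_p -> 'cV[R]_p -> R)
  (ysp y : 'cV[R]_p) : Prop :=
  Y y /\ forall y', Y y' -> VO y ysp <= VO y' ysp.

End MPC.

Definition convex2 (R : realType) (p : nat) (f : 'cV[R]_p -> 'cV[R]_p -> R) : Prop :=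
  forall (t : R) a a' b b', 0 <= t <= 1 ->
    f (t *: a + (1 - t) *: b) (t *: a' + (1 - t) *: b')
      <= t * f a a' + (1 - t) * f b b'.

Definition subdiff2 (R : realType) (p : nat) (f : 'cV[R]_p -> 'cV[R]_p -> R) : Prop :=
  forall y ys, exists g1 g2 : 'cV[R]_p, forall y' ys',
    f y ys + (g1^T *m (y' - y)) 0 0 + (g2^T *m (ys' - ys)) 0 0 <= f y' ys'.

(* Main.v *)
Require Import Defs.
From HB Require Import structures.
From mathcomp Require Import all_boot all_order all_algebra.
From mathcomp Require Import all_classical all_reals all_analysis.
From mathcomp Require Import ring lra.
Set Implicit Arguments. Unset Strict Implicit. Unset Printing Implicit Defensive.
Import Order.TTheory GRing.Theory Num.Theory.
Import numFieldNormedType.Exports.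
Local Open Scope ring_scope.
Local Open Scope classical_set_scope.

(** The optimal cost [V] is a Lyapunov function. Appending the artificial
    equilibrium to the tail of an optimal plan gives a feasible plan for the
    successor state, so [V] decreases by the stage cost and its increments tend
    to [0]. The cost is strongly convex in the artificial state (the terminal
    equality together with observability makes the stage costs coercive), so the
    artificial state [xa] moves by at most the square root of the decrease of
    [V]; observability, in a form that tolerates this drift, then gives
    [x - xa -> 0]. Near an equilibrium, controllability makes it feasible to move
    [xa] a fraction [b] of the way to the target at a price quadratic in [b] and
    [x - xa], while convexity of [VO] makes the gain linear in [b]; optimality
    therefore forces the offset cost of [xa] to its minimum. Since [0] is interior to
    [Z], the output determines an admissible equilibrium linearly, and convergence
    of the offset cost to its unique minimum gives convergence of [xa]. *)

Section MatrixNorm.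
Variable R : realType.

Lemma scaler_halves (U : lmodType R) (v : U) : 2^-1 *: v + 2^-1 *: v = v.
Proof. by rewrite -scalerDl -[RHS]scale1r; congr (_ *: _); field. Qed.

Lemma mx_norm_entry (a b : nat) (M : 'M[R]_(a, b)) i j : `|M i j| <= `|M|.
Proof.
by rewrite [leRHS]/Num.norm /= mx_normrE; apply/bigmax_geP; right => /=; exists (i, j).
Qed.

Lemma mx_norm_le (a b : nat) (M : 'M[R]_(a, b)) c :
  0 <= c -> (forall i j, `|M i j| <= c) -> `|M| <= c.
Proof.
by move=> c0 h; rewrite [leLHS]/Num.norm /= mx_normrE; apply/bigmax_leP; split.
Qed.

Lemma trmx_norm (a b : nat) (M : 'M[R]_(a, b)) : `|M^T| = `|M|.
Proof.
apply/eqP; rewrite eq_le; apply/andP.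
split; apply: mx_norm_le => // i j.
  by rewrite mxE mx_norm_entry.
by have := mx_norm_entry M^T j i; rewrite mxE.
Qed.

Lemma mulmx_norm_le (a b d : nat) (M : 'M[R]_(a, b)) (v : 'M[R]_(b, d)) :
  `|M *m v| <= b%:R * `|M| * `|v|.
Proof.
apply: mx_norm_le => [|i j]; first by rewrite !mulr_ge0.
rewrite mxE (le_trans (ler_norm_sum _ _ _))//.
apply: (@le_trans _ _ (\sum_(k < b) `|M| * `|v|)).
  by apply: ler_sum => k _; rewrite normrM ler_pM// mx_norm_entry.
by rewrite sumr_const card_ord -mulrA mulr_natl.
Qed.

Lemma col_mx_norm_lt (a b : nat) (x : 'cV[R]_a) (u : 'cV[R]_b) c :
  0 < c -> `|x| < c -> `|u| < c -> `|col_mx x u| < c.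
Proof.
move=> c0 xc uc; apply: (@le_lt_trans _ _ (Num.max `|x| `|u|)); last first.
  by rewrite gt_max xc uc.
apply: mx_norm_le => [|i j]; first by rewrite le_max normr_ge0.
rewrite le_max; case: (split_ordP i) => k ->.
  by rewrite col_mxEu mx_norm_entry.
by rewrite col_mxEd mx_norm_entry orbT.
Qed.

Lemma usubmx_norm_le (a b : nat) (v : 'cV[R]_(a + b)) : `|usubmx v| <= `|v|.
Proof. by apply: mx_norm_le => // i j; rewrite mxE mx_norm_entry. Qed.

Lemma dsubmx_norm_le (a b : nat) (v : 'cV[R]_(a + b)) : `|dsubmx v| <= `|v|.
Proof. by apply: mx_norm_le => // i j; rewrite mxE mx_norm_entry. Qed.

Lemma trmx_continuous (a b : nat) : continuous (@trmx R a b).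
Proof.
move=> M; apply/(@cvgrPdist_lt R _ _ (nbhs M) _ trmx M^T) => e e0.
near=> M'; rewrite -linearB /= trmx_norm.
near: M'; exact: (@cvgr_dist_lt _ _ _ (nbhs M) _ id M).
Unshelve. all: by end_near. Qed.

Lemma mulmxl_continuous (a b d : nat) (M : 'M[R]_(a, b)) :
  continuous (fun v : 'M[R]_(b, d) => M *m v).
Proof.
move=> v; apply/(@cvgrPdist_lt R _ _ (nbhs v) _ (mulmx M) (M *m v)) => e e0.
near=> w; rewrite -mulmxBr (le_lt_trans (mulmx_norm_le _ _))//.
have c0 : 0 < b%:R * `|M| + 1 by rewrite ltr_wpDl// mulr_ge0.
apply: (@le_lt_trans _ _ ((b%:R * `|M| + 1) * `|v - w|)).
  by rewrite ler_wpM2r// lerDl.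
rewrite mulrC -ltr_pdivlMr//; near: w.
by apply: (@cvgr_dist_lt _ _ _ (nbhs v) _ id v) => //; rewrite divr_gt0.
Unshelve. all: by end_near. Qed.

Lemma closed_mulmx_le (a b : nat) (M : 'M[R]_(a, b)) (d : 'cV[R]_a) :
  closed [set y : 'cV[R]_b | forall i, (M *m y) i 0 <= d i 0].
Proof.
rewrite (_ : [set y | _] = \bigcap_i [set y : 'cV[R]_b | (M *m y) i 0 <= d i 0]).
  apply: closed_bigI => i _.
  apply: (@preimage_closed _ _ (fun y : 'cV[R]_b => (M *m y) i 0) [set x | x <= d i 0]).
    move=> y _.
    apply: (@continuous_comp _ _ _ (mulmx M) (fun z : 'cV[R]_a => z i 0)).
      exact: mulmxl_continuous.
    exact: coord_continuous.
  exact: closed_le.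
by apply/seteqP; split=> y /= h i => [_|]; apply: h.
Qed.

Lemma closed_mulmx_eq (a b : nat) (M N : 'M[R]_(a, b)) :
  closed [set y : 'cV[R]_b | M *m y = N *m y].
Proof.
rewrite (_ : [set y | _] =
  [set y : 'cV[R]_b | forall i, ((M - N) *m y) i 0 <= (0 : 'cV[R]_a) i 0] `&`
  [set y : 'cV[R]_b | forall i, ((N - M) *m y) i 0 <= (0 : 'cV[R]_a) i 0]).
  by apply: closedI; exact: closed_mulmx_le.
apply/seteqP; split=> y /=; rewrite !mulmxBl.
  by move=> ->; split=> i; rewrite subrr.
move=> [h h']; apply/matrixP => i j; rewrite (ord1 j); apply/eqP.
by rewrite eq_le; move: (h i) (h' i); rewrite !mxE !subr_le0 => -> ->.
Qed.

Lemma compact_cV (p : nat) (K : set 'cV[R]_p) :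
  bounded_set K -> closed K -> compact K.
Proof.
move=> bK cK.
have -> : K = trmx @` [set v : 'rV[R]_p | K v^T].
  apply/seteqP; split=> [v Kv|v [w /= Kw <-]//]; exists v^T; rewrite /= ?trmxK//.
apply: continuous_compact; first exact/continuous_subspaceT/trmx_continuous.
apply: bounded_closed_compact.
  move: bK => [M [Mr hM]]; exists M; split=> // x Mx w /= Kw.
  by rewrite -trmx_norm; exact: hM.
by apply: (@preimage_closed _ _ _ K) => //; exact: in1W (@trmx_continuous 1 p).
Qed.

End MatrixNorm.

Section QuadraticForms.
Variable R : realType.
Variable k : nat.
Implicit Types (M : 'M[R]_k) (v w : 'cV[R]_k).

Lemma trmx_bilin M v w : (v^T *m M^T *m w) 0 0 = (w^T *m M *m v) 0 0.
Proof.
by rewrite -[in RHS](trmxK (w^T *m M *m v)) [RHS]mxE !trmx_mul trmxK mulmxA.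
Qed.

Lemma qform_bilin M (s t : R) v w :
  qform M (s *: v + t *: w) = s ^+ 2 * qform M v + t ^+ 2 * qform M w
    + s * t * ((v^T *m M *m w) 0 0 + (w^T *m M *m v) 0 0).
Proof.
have tr : (s *: v + t *: w)^T = s *: v^T + t *: w^T by rewrite linearD !linearZ.
rewrite /qform tr !mulmxDr !mulmxDl -!scalemxAl -!scalemxAr.
rewrite !mxE; ring.
Qed.

Lemma qform_mid M v w :
  qform M (2^-1 *: v + 2^-1 *: w) =
  2^-1 * (qform M v + qform M w) - 4^-1 * qform M (v - w).
Proof.
have -> : v - w = 1 *: v + (-1) *: w by rewrite scale1r scaleN1r.
by rewrite !qform_bilin; field.
Qed.

Lemma qform_le M v : qform M v <= k%:R ^+ 2 * `|M| * `|v| ^+ 2.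
Proof.
rewrite /qform (le_trans (ler_norm _))// (le_trans (mx_norm_entry _ _ _))//.
rewrite (le_trans (mulmx_norm_le _ _))//.
apply: (@le_trans _ _ (k%:R * (k%:R * `|v| * `|M|) * `|v|)); last first.
  by rewrite le_eqVlt; apply/orP; left; apply/eqP; ring.
rewrite ler_wpM2r// ler_wpM2l// (le_trans (mulmx_norm_le _ _))//.
by rewrite trmx_norm.
Qed.

Lemma qform_sqr (H : 'M[R]_k) v : H^T = H -> `|H *m v| ^+ 2 <= qform (H *m H) v.
Proof.
move=> Hs.
have -> : qform (H *m H) v = \sum_i (H *m v) i 0 ^+ 2.
  rewrite /qform -mulmxA -mulmxA mulmxA -[X in _ *m X *m _]Hs -trmx_mul mxE.
  by apply: eq_bigr => i _; rewrite mxE expr2.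
have s0 : 0 <= \sum_i (H *m v) i 0 ^+ 2 by apply: sumr_ge0 => i _; exact: sqr_ge0.
rewrite -[leRHS](sqr_sqrtr s0) ler_sqr ?nnegrE ?sqrtr_ge0//.
apply: mx_norm_le => [|i j]; first exact: sqrtr_ge0.
rewrite (ord1 j) -sqrtr_sqr ler_wsqrtr// (bigD1 i)//= lerDl.
by apply: sumr_ge0 => l _; exact: sqr_ge0.
Qed.

(* Each coordinate of [v] is the product [(S^-1 e_i)^T S v] with [S = M + M^T],
   so Cauchy-Schwarz for the form [S] bounds it by the form itself. *)
Lemma posdef_lower M : posdef_mx M ->
  exists2 c, 0 < c & forall v, `|v| ^+ 2 <= c * qform M v.
Proof.
move=> Mpd.
pose S := M + M^T.
have Sq v : (v^T *m S *m v) 0 0 = 2 * qform M v.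
  by rewrite mulmxDr mulmxDl mxE trmx_bilin /qform; ring.
have q0 v : 0 <= qform M v.
  have [->|v0] := eqVneq v 0; last exact/ltW/Mpd.
  by rewrite /qform mulmx0 mxE.
have ST : S^T = S by rewrite /S linearD /= trmxK addrC.
have Su : S \in unitmx.
  rewrite -row_free_unit; apply: inj_row_free => w wS.
  apply/eqP; apply: contraT => w0.
  have : w^T != 0 by apply: contra_neq w0 => /(congr1 trmx); rewrite trmxK trmx0.
  move=> /Mpd; rewrite -(ltr_pM2l (ltr0Sn R 1)) -Sq trmxK wS mul0mx mxE mulr0 ltxx.
  by [].
have CS v w : ((w^T *m S *m v) 0 0) ^+ 2 <= 4 * qform M w * qform M v.
  set b := (w^T *m S *m v) 0 0.
  have bE : (w^T *m M *m v) 0 0 + (v^T *m M *m w) 0 0 = b.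
    by rewrite /b /S mulmxDr mulmxDl [in RHS]mxE trmx_bilin.
  have H s t : 0 <= s ^+ 2 * qform M w + t ^+ 2 * qform M v + s * t * b.
    by rewrite -bE -qform_bilin.
  have [w0|w0] := eqVneq w 0.
    by rewrite /b w0 trmx0 !mul0mx mxE /qform mulmx0 mxE expr0n /= mulr0 mul0r.
  have qw := Mpd _ w0.
  have := H b (- 2 * qform M w); set x := qform M w in qw *; set y := qform M v.
  have -> : b ^+ 2 * x + (-2 * x) ^+ 2 * y + b * (-2 * x) * b =
            x * (4 * x * y - b ^+ 2) by ring.
  by rewrite pmulr_rge0// subr_ge0.
pose d i : 'cV[R]_k := invmx S *m delta_mx i 0.
exists (1 + \sum_i 4 * qform M (d i)).
  rewrite ltr_wpDr//; apply: sumr_ge0 => i _; by rewrite mulr_ge0.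
move=> v; set c := 1 + _.
have vi i : `|v i 0| ^+ 2 <= c * qform M v.
  have -> : v i 0 = ((d i)^T *m S *m v) 0 0.
    rewrite /d trmx_mul trmx_inv ST -(mulmxA _ (invmx S)) mulVmx// mulmx1.
    by rewrite trmx_delta -rowE mxE.
  rewrite real_normK ?num_real// (le_trans (CS _ _))// ler_wpM2r//.
  rewrite /c (bigD1 i)//= addrCA lerDl addr_ge0// sumr_ge0// => j _.
  by rewrite mulr_ge0.
have c0 : 0 <= c * qform M v.
  by rewrite mulr_ge0// /c addr_ge0// sumr_ge0// => j _; rewrite mulr_ge0.
rewrite -[leRHS](sqr_sqrtr c0) ler_sqr ?nnegrE ?sqrtr_ge0//.
apply: mx_norm_le => [|i j]; first exact: sqrtr_ge0.
by rewrite (ord1 j) -[leLHS]ger0_norm// -sqrtr_sqr ler_wsqrtr.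
Qed.

End QuadraticForms.

Section LinearSystems.
Variable R : realType.
Variables (n m : nat).
Implicit Types (A : 'M[R]_n) (B : 'M[R]_(n, m)).

Lemma iterate_defect_bound A (k : nat) (M : 'M[R]_(k, n)) (j : nat) :
  exists2 c, 0 <= c & forall e : nat -> 'cV[R]_n,
    `|M *m A ^+ j *m e 0%N| <=
      `|M *m e j| + c * \sum_(i < j) `|e i.+1 - A *m e i|.
Proof.
elim: j M => [|j IH] M.
  by exists 0 => // e; rewrite expr0 mulmx1 mul0r addr0.
have [c c0 hc] := IH (M *m A).
exists (c + n%:R * `|M|); first by rewrite addr_ge0// mulr_ge0.
move=> e; rewrite exprS -mulmxE (mulmxA M) (le_trans (hc e))// big_ord_recr /=.
set s := \sum_(i < j) _; set w := e j.+1 - _.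
have s0 : 0 <= s by apply: sumr_ge0.
have -> : M *m A *m e j = M *m e j.+1 - M *m w.
  by rewrite -mulmxBr /w opprB addrC subrK mulmxA.
have := ler_normB (M *m e j.+1) (M *m w).
have := mulmx_norm_le M w.
have : 0 <= n%:R * `|M| * s by rewrite !mulr_ge0.
have : 0 <= c * `|w| by rewrite !mulr_ge0.
lra.
Qed.

(* Observability as an estimate that tolerates a defect [e_(j+1) - A e_j]; the
   defect is the input for open-loop predictions, and the input plus the drift
   of the artificial reference in closed loop. *)
Lemma observable_bound (k : nat) (H : 'M[R]_(k, n)) A : observable H A ->
  exists2 c, 0 < c & forall e : nat -> 'cV[R]_n,
    `|e 0%N| <= c * \sum_(j < n) (`|H *m e j| + `|e j.+1 - A *m e j|).
Proof.
move=> obs.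
set O := \mxcol_(j < n) (H *m A ^+ j) in obs.
have /row_fullP[L LO] : row_full O by rewrite /row_full -[X in _ == X]obs.
have /choice[c hc] : forall j : 'I_n, exists c, 0 <= c /\ forall e : nat -> 'cV[R]_n,
    `|H *m A ^+ j *m e 0%N| <=
      `|H *m e j| + c * \sum_(i < j) `|e i.+1 - A *m e i|.
  by move=> j; have [c c0 hc] := iterate_defect_bound A H j; exists c.
pose cc := 1 + \sum_j c j.
have cc1 : 1 <= cc by rewrite lerDl sumr_ge0// => j _; have [] := hc j.
pose d := (\sum_(j < n) k)%N%:R * `|L|.
have d0 : 0 <= d by rewrite mulr_ge0.
exists (d * cc + 1); first by rewrite ltr_wpDl// mulr_ge0// (le_trans ler01).
move=> e; set S := \sum_(j < n) _.
have S0 : 0 <= S by apply: sumr_ge0 => j _; rewrite addr_ge0.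
have Oe : `|O *m e 0%N| <= cc * S.
  apply: mx_norm_le => [|i j]; first by rewrite mulr_ge0// (le_trans ler01).
  rewrite /O mxcol_mul mxE (le_trans (mx_norm_entry _ _ _))//.
  set l := tagnat.sig1 i; have [cl0 hl] := hc l.
  rewrite (le_trans (hl e))//.
  have w0 : \sum_(i0 < l) `|e i0.+1 - A *m e i0| <= S.
    apply: (@le_trans _ _ (\sum_(j < n) `|e j.+1 - A *m e j|)).
      rewrite (big_ord_widen n (fun i0 : nat => `|e i0.+1 - A *m e i0|)).
        rewrite big_mkcond /=; apply: ler_sum => i0 _.
        by case: ifP.
      exact/ltnW/ltn_ord.
    by apply: ler_sum => i0 _; rewrite lerDr.
  have h0 : `|H *m e l| <= S.
    rewrite /S (bigD1 l)//= -addrA lerDl addr_ge0// sumr_ge0// => i0 _.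
  have cl : 1 + c l <= cc.
    rewrite /cc lerD2l (bigD1 l)//= lerDl sumr_ge0// => i0 _.
    by have [] := hc i0.
  have := ler_wpM2l cl0 w0; have := ler_wpM2r S0 cl; lra.
rewrite -[e 0%N]mul1mx -LO -mulmxA (le_trans (mulmx_norm_le _ _))// -/d.
have := ler_wpM2l d0 Oe; lra.
Qed.

Lemma xpredE A B x u k :
  xpred A B x u k = A ^+ k *m x + \sum_(j < k) A ^+ (k.-1 - j) *m B *m u j.
Proof.
have AX a : A *m A ^+ a = A ^+ a.+1 by rewrite exprS.
elim: k => [|k IH]; first by rewrite big_ord0 addr0 expr0 mul1mx.
rewrite [LHS]/= IH mulmxDr mulmxA AX -addrA; congr (_ + _).
rewrite big_ord_recr /= subnn expr0 mul1mx mulmx_sumr; congr (_ + _).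
apply: eq_bigr => j _; rewrite !mulmxA AX; congr (A ^+ _ *m B *m u j).
by case: k j {IH} => [[]//|k j] /=; rewrite subSn// -ltnS.
Qed.

Lemma xpred_lin A B (s t : R) x y u v k :
  xpred A B (s *: x + t *: y) (fun j => s *: u j + t *: v j) k =
  s *: xpred A B x u k + t *: xpred A B y v k.
Proof.
elim: k => [//|k IH] /=; rewrite IH !mulmxDr -!scalemxAr !scalerDr.
by rewrite addrACA.
Qed.

Lemma xpred_equilibrium A B x u k : x = A *m x + B *m u ->
  xpred A B x (fun=> u) k = x.
Proof. by move=> eq; elim: k => [//|k IH] /=; rewrite IH -eq. Qed.

Lemma xpred_error A B (xs x : 'cV[R]_n) (us : 'cV[R]_m) u k : xs = A *m xs + B *m us ->
  xpred A B (x - xs) (fun j => u j - us) k = xpred A B x u k - xs.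
Proof.
move=> eq; have := xpred_lin A B 1 (-1) x xs u (fun=> us) k.
rewrite !scale1r !scaleN1r xpred_equilibrium// => <-; congr (xpred _ _ _ _ _).
by apply/funext => j; rewrite scale1r.
Qed.

Lemma xpred_shift A B x u k :
  xpred A B (A *m x + B *m u 0%N) (fun j => u j.+1) k = xpred A B x u k.+1.
Proof. by elim: k => [//|k IH]; rewrite [LHS]/= IH. Qed.

Lemma eq_xpred A B x u v k : (forall j, (j < k)%N -> u j = v j) ->
  xpred A B x u k = xpred A B x v k.
Proof.
elim: k => [//|k IH] uv /=; rewrite uv// IH// => j jk.
by apply: uv; exact: ltnW.
Qed.

Lemma steering A B (nc N : nat) : \rank (ctrb_mx A B nc) = n -> (nc <= N)%N ->
  exists2 c, 0 < c & forall e, exists v, xpred A B e v N = 0 /\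
    forall j, (j < N)%N -> `|xpred A B e v j| <= c * `|e| /\ `|v j| <= c * `|e|.
Proof.
move=> rk ncN.
have /row_freeP[P CP] : row_free (ctrb_mx A B nc) by rewrite /row_free rk.
pose K (j : nat) : 'M[R]_(m, n) :=
  if (insub j : option 'I_nc) is Some i then - (submxcol P i *m A ^+ nc) else 0.
pose fix Phi (j : nat) : 'M[R]_n :=
  if j is j'.+1 then A *m Phi j' + B *m K j' else 1%:M.
have PhiE e j : xpred A B e (fun j => K j *m e) j = Phi j *m e.
  elim: j => [|j IH] /=; first by rewrite mul1mx.
  by rewrite IH mulmxDl !mulmxA.
have Kj (j : 'I_nc) : K j = - (submxcol P j *m A ^+ nc).
  by rewrite /K valK.
have Pnc (e : 'cV[R]_n) : Phi nc *m e = 0.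
  rewrite -PhiE xpredE.
  have -> : \sum_(j < nc) A ^+ (nc.-1 - j) *m B *m (K j *m e) =
            - (ctrb_mx A B nc *m P *m (A ^+ nc *m e)).
    rewrite -[P in RHS]submxcolK mul_mxrow_mxcol mulmx_suml -sumrN.
    by apply: eq_bigr => j _; rewrite Kj !mulNmx mulmxN !mulmxA.
  by rewrite CP mul1mx subrr.
have P0 (e : 'cV[R]_n) d : Phi (nc + d)%N *m e = 0.
  elim: d => [|d IH]; first by rewrite addn0.
  rewrite addnS /= mulmxDl -mulmxA IH mulmx0 add0r /K insubF ?mulmx0 ?mul0mx//.
  by rewrite ltnNge leq_addr.
pose c := 1 + \sum_(j < N) (n%:R * `|Phi j| + n%:R * `|K j|).
exists c; first by rewrite ltr_wpDr// sumr_ge0// => j _; rewrite addr_ge0// mulr_ge0.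
move=> e; exists (fun j => K j *m e); split; first by rewrite PhiE -(subnKC ncN).
move=> j jN; rewrite PhiE.
have : n%:R * `|Phi j| + n%:R * `|K j| <= c.
  rewrite /c (bigD1 (Ordinal jN))//= addrCA lerDl addr_ge0// sumr_ge0// => i _.
move=> hc; have c1 : 0 <= n%:R * `|Phi j| by rewrite mulr_ge0.
have c2 : 0 <= n%:R * `|K j| by rewrite mulr_ge0.
split; rewrite (le_trans (mulmx_norm_le _ _))// ler_wpM2r//; lra.
Qed.

Lemma open_loop_coercive A B (Qh : 'M[R]_n) (Rw : 'M[R]_m) (N : nat) :
  Qh^T = Qh -> observable Qh A -> posdef_mx Rw ->
  exists2 c, 0 < c & forall e v, xpred A B e v N = 0 ->
    `|e| ^+ 2 <= c * \sum_(j < N) (qform (Qh *m Qh) (xpred A B e v j) + qform Rw (v j)).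
Proof.
move=> Qs obs Rpd.
have [c c0 hc] := observable_bound obs.
have [d d0 hd] := posdef_lower Rpd.
pose b := m%:R * `|B|; have b0 : 0 <= b by rewrite mulr_ge0.
pose a := c * (n%:R * (1 + b * Num.sqrt d)).
have a0 : 0 <= a.
  by rewrite !mulr_ge0 ?(ltW c0)// addr_ge0// mulr_ge0// sqrtr_ge0.
exists (a ^+ 2 + 1); first by rewrite ltr_wpDl// sqr_ge0.
move=> e v eN; pose s j := qform (Qh *m Qh) (xpred A B e v j) + qform Rw (v j).
have Q0 w : 0 <= qform (Qh *m Qh) w by rewrite (le_trans _ (qform_sqr _ Qs))// sqr_ge0.
have R0 w : 0 <= qform Rw w.
  by rewrite -(pmulr_rge0 _ d0) (le_trans _ (hd w))// sqr_ge0.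
have s0 j : 0 <= s j by rewrite addr_ge0.
pose S := \sum_(j < N) s j; rewrite -/S.
have S0 : 0 <= S by apply: sumr_ge0.
have sS j : (j < N)%N -> s j <= S.
  move=> jN; rewrite /S (bigD1 (Ordinal jN))//= lerDl sumr_ge0//.
have Qj j : (j < N)%N -> `|Qh *m xpred A B e v j| <= Num.sqrt S.
  move=> jN; rewrite -[leLHS]ger0_norm// -sqrtr_sqr ler_wsqrtr//.
  rewrite (le_trans (qform_sqr _ Qs))// (le_trans _ (sS _ jN))//.
  by rewrite /s lerDl.
have vj j : (j < N)%N -> `|v j| <= Num.sqrt d * Num.sqrt S.
  move=> jN; rewrite -sqrtrM ?(ltW d0)// -[leLHS]ger0_norm// -sqrtr_sqr ler_wsqrtr//.
  rewrite (le_trans (hd _))// ler_wpM2l ?(ltW d0)// (le_trans _ (sS _ jN))//.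
  by rewrite /s lerDr.
pose ee j := if (j < N)%N then xpred A B e v j else 0.
have eeE j : (j <= N)%N -> ee j = xpred A B e v j.
  rewrite /ee leq_eqVlt => /orP[/eqP->|->//]; by rewrite ltnn.
have e0 : e = ee 0%N by rewrite eeE.
have eS : `|e| <= a * Num.sqrt S.
  rewrite [in leLHS]e0 (le_trans (hc ee))// /a -mulrA ler_wpM2l ?(ltW c0)//.
  apply: (@le_trans _ _ (\sum_(j < n) (1 + b * Num.sqrt d) * Num.sqrt S)); last first.
    by rewrite sumr_const card_ord -[leLHS]mulr_natl mulrA.
  apply: ler_sum => j _; case: (ltnP j N) => jN.
    rewrite !eeE//; last exact: ltnW.
    rewrite /= addrAC subrr add0r mulrDl mul1r lerD ?Qj//.
    rewrite (le_trans (mulmx_norm_le _ _))// -/b -mulrA ler_wpM2l//.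
    exact: vj.
  rewrite /ee !ltnNge jN (leq_trans jN (leqnSn _)) /= !mulmx0 subr0 normr0 addr0.
  by rewrite mulr_ge0 ?sqrtr_ge0// addr_ge0// mulr_ge0 ?sqrtr_ge0.
rewrite mulrDl mul1r; apply: ler_wpDr => //.
rewrite -[X in _ <= _ * X](sqr_sqrtr S0) -exprMn ler_sqr// ?nnegrE//.
by rewrite mulr_ge0// sqrtr_ge0.
Qed.

End LinearSystems.

Section ConvexMinimization.
Variables (R : realType) (p : nat).
Implicit Types (f : 'cV[R]_p -> R) (K Y : set 'cV[R]_p).

Definition subdiff1 f := forall y, exists s : 'cV[R]_p, forall y',
  f y + (s^T *m (y' - y)) 0 0 <= f y'.

Definition convex1 f := forall (t : R) y y', 0 <= t <= 1 ->
  f (t *: y + (1 - t) *: y') <= t * f y + (1 - t) * f y'.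

Definition convex_set1 Y := forall (t : R) y y', 0 <= t <= 1 -> Y y -> Y y' ->
  Y (t *: y + (1 - t) *: y').

(* Subgradients make [f] lower semicontinuous, which is all that the extreme
   value theorem needs here. *)
Lemma subdiff_attains_min f K : compact K -> K !=set0 -> (forall y, 0 <= f y) ->
  subdiff1 f -> exists2 y, K y & forall y', K y' -> f y <= f y'.
Proof.
move=> cK [y0 Ky0] f0 sf.
pose I := inf (f @` K).
have lbI : lbound (f @` K) 0 by move=> _ [y _ <-].
have hI : has_inf (f @` K) by split; [exists (f y0), y0 | exists 0].
have If y : K y -> I <= f y.
  by move=> Ky; apply: ge_inf; [exists 0 | exists y].
apply: contrapT => nmin.
have Ilt y : K y -> I < f y.
  move=> Ky; rewrite lt_neqAle If// andbT; apply/eqP => Iy.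
  by apply: nmin; exists y => // y' Ky'; rewrite -Iy If.
have /compact_near_coveringP/(_ _ (0 : R)^'+ (fun e y => I + e < f y) _) := cK.
move=> /(_ _)[].
  move=> y Ky; have [s hs] := sf y.
  have d0 : 0 < (f y - I) / 2 by rewrite divr_gt0// subr_gt0 Ilt.
  pose c := p%:R * `|s| + 1; have c0 : 0 < c by rewrite ltr_wpDl// mulr_ge0.
  near=> y' e => /=.
  have e1 : e < (f y - I) / 2.
    by near: e; exact: nbhs_right_lt.
  have y1 : `|y - y'| < (f y - I) / 2 / c.
    by near: y'; apply: (@cvgr_dist_lt _ _ _ (nbhs y) _ id y) => //; rewrite divr_gt0.
  have y2 : `|(s^T *m (y' - y)) 0 0| <= c * `|y - y'|.
    rewrite (le_trans (mx_norm_entry _ _ _))// (le_trans (mulmx_norm_le _ _))//.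
    by rewrite trmx_norm distrC ler_wpM2r// lerDl.
  have y3 : c * `|y - y'| < (f y - I) / 2 by rewrite mulrC -ltr_pdivlMr.
  have := hs y'; move: y2; rewrite ler_norml => /andP[]; lra.
move=> e /= e0 he.
have [z [z0 zP]] : exists z, 0 < z /\ forall y, K y -> I + z < f y.
  exists (e / 2); split; first by rewrite divr_gt0.
  move=> y Ky; apply: he => //=; last by rewrite divr_gt0.
  rewrite sub0r normrN gtr0_norm ?divr_gt0//; lra.
have : I + z <= I.
  apply: lb_le_inf; first by exists (f y0), y0.
  by move=> _ [y Ky <-]; rewrite ltW// zP.
lra.
Unshelve. all: by end_near. Qed.

Lemma dist_continuous (y : 'cV[R]_p) : continuous (fun z : 'cV[R]_p => `|z - y|).
Proof.
move=> z; apply: (@cvg_norm _ _ _ (nbhs z) _ (fun z => z - y) (z - y)).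
by apply: (@cvgB _ _ _ (nbhs z) _ id (fun=> y) z y); [exact: cvg_id|exact: cvg_cst].
Qed.

Lemma sphere_section_compact Y (y : 'cV[R]_p) (r : R) : closed Y ->
  compact [set z | Y z /\ `|z - y| = r].
Proof.
move=> cY; apply: compact_cV.
  exists (`|y| + `|r|); split; first exact: num_real.
  move=> x hx z /= [_ zr]; have := ler_norm r.
  have := ler_normD (z - y) y; rewrite subrK zr; lra.
rewrite (_ : [set z | _] = Y `&` (fun z => `|z - y|) @^-1` [set r])//.
apply: closedI => //; apply: preimage_closed.
  by move=> z _; exact: dist_continuous.
exact: closed_eq.
Qed.

Lemma ball_section_compact Y (y : 'cV[R]_p) (r : R) : closed Y ->
  compact [set z | Y z /\ `|z - y| <= r].
Proof.
move=> cY; apply: compact_cV.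
  exists (`|y| + r); split; first exact: num_real.
  move=> x hx z /= [_ zr].
  have := ler_normD (z - y) y; rewrite subrK; lra.
rewrite (_ : [set z | _] = Y `&` (fun z => `|z - y|) @^-1` [set x | x <= r])//.
apply: closedI => //; apply: preimage_closed.
  by move=> z _; exact: dist_continuous.
exact: closed_le.
Qed.

(* Compare with the minimum of [f] on the sphere of radius [eps] around [yt]. *)
Lemma convex_linear_growth f Y (yt : 'cV[R]_p) (eps : R) :
  closed Y -> convex_set1 Y -> (forall y, 0 <= f y) -> subdiff1 f -> convex1 f ->
  Y yt -> (forall y, Y y -> f y <= f yt -> y = yt) -> 0 < eps ->
  exists2 eta, 0 < eta &
    forall y, Y y -> eps <= `|y - yt| -> eta * `|y - yt| <= f y - f yt.
Proof.
move=> cY coY f0 sf cf Yt ut e0.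
pose K := [set z | Y z /\ `|z - yt| = eps].
have radial y : Y y -> eps <= `|y - yt| -> exists z, K z /\
    `|y - yt| * (f z - f yt) <= eps * (f y - f yt).
  move=> Yy ey; have d0 : 0 < `|y - yt| by exact: lt_le_trans ey.
  pose t := eps / `|y - yt|.
  have t01 : 0 <= t <= 1.
    by rewrite divr_ge0 ?(ltW e0)//= ler_pdivrMr// mul1r.
  exists (t *: y + (1 - t) *: yt); split.
    split; first exact: coY.
    have -> : t *: y + (1 - t) *: yt - yt = t *: (y - yt).
      by rewrite scalerBl scale1r scalerBr -!addrA; congr (_ + _);
        rewrite addrCA subrr addr0.
    have [t0 _] := andP t01.
    by rewrite normrZ (ger0_norm t0) divfK// gt_eqF.
  have := cf t y yt t01; rewrite -(ler_pM2l d0).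
  have te : `|y - yt| * t = eps by rewrite mulrC divfK// gt_eqF.
  have -> : `|y - yt| * (t * f y + (1 - t) * f yt) =
    `|y - yt| * t * f y + `|y - yt| * f yt - `|y - yt| * t * f yt by ring.
  rewrite te; lra.
have [K0|K0] := pselect (K !=set0); last first.
  exists 1 => // y Yy ey; have [z [Kz _]] := radial y Yy ey.
  by case: K0; exists z.
have [z [Yz zE] zmin] := subdiff_attains_min (sphere_section_compact cY) K0 f0 sf.
have fz : f yt < f z.
  rewrite ltNge; apply/negP => /(ut _ Yz) zt.
  by move: zE; rewrite zt subrr normr0 => /esym/eqP; rewrite gt_eqF.
exists ((f z - f yt) / eps); first by rewrite divr_gt0// subr_gt0.
move=> y Yy ey; have [w [Kw hw]] := radial y Yy ey.
rewrite mulrAC ler_pdivrMr// [leRHS]mulrC (le_trans _ hw)// mulrC ler_wpM2l//.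
by rewrite lerD2r zmin.
Qed.

Lemma convex_attains_min f Y (y0 y1 : 'cV[R]_p) :
  closed Y -> (forall y, 0 <= f y) -> subdiff1 f -> convex1 f ->
  Y y1 -> (forall y, f y <= f y0 -> y = y0) ->
  exists2 y, Y y & forall y', Y y' -> f y <= f y'.
Proof.
move=> cY f0 sf cf Y1 u0.
have [eta e0 he] : exists2 eta, 0 < eta &
    forall y, setT y -> 1 <= `|y - y0| -> eta * `|y - y0| <= f y - f y0.
  by apply: convex_linear_growth => // y _; exact: u0.
pose b := 1 + f y1 / eta + `|y1 - y0|.
have fe : 0 <= f y1 / eta by rewrite divr_ge0// ltW.
have K1 : [set z | Y z /\ `|z - y0| <= b] y1.
  by split=> //; rewrite /b lerDr addr_ge0.
have [z [Yz zb] zmin] := subdiff_attains_min (ball_section_compact (y:=y0) (r:=b) cY)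
  (ex_intro _ _ K1) f0 sf.
exists z => // y Yy; have [yb|yb] := leP `|y - y0| b; first exact: zmin.
rewrite (le_trans (zmin _ K1))//.
have y1' : 1 <= `|y - y0| by rewrite (le_trans _ (ltW yb))// /b -addrA lerDl addr_ge0.
have := he y I y1'; have := f0 y0.
have : f y1 <= eta * `|y - y0|.
  rewrite mulrC -ler_pdivrMr// (le_trans _ (ltW yb))// /b.
  have := normr_ge0 (y1 - y0); lra.
lra.
Qed.

End ConvexMinimization.

Section ReachableSetpoints.
Variables (R : realType) (n m p q : nat).
Variables (A : 'M[R]_n) (B : 'M[R]_(n, m)) (C : 'M[R]_(p, n)) (D : 'M[R]_(p, m)).
Variables (G : 'M[R]_(q, n + m)) (g : 'cV[R]_q) (lam : R).
Hypothesis hlam : 0 <= lam < 1.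
Hypothesis hZint : interior (Zset G g) (0 : 'cV[R]_(n + m)).

Lemma inZ_ball : exists2 e, 0 < e & forall x u, `|x| < e -> `|u| < e -> inZ G g x u.
Proof.
have /nbhs_ballP[e /= e0 he] : nbhs (0 : 'cV[R]_(n + m)) (Zset G g) := hZint.
exists e => // x u xe ue; apply: he.
rewrite -ball_normE /= sub0r normrN; exact: col_mx_norm_lt.
Qed.

Lemma inZ_conv (t : R) x u x' u' : 0 <= t <= 1 -> inZ G g x u -> inZ G g x' u' ->
  inZ G g (t *: x + (1 - t) *: x') (t *: u + (1 - t) *: u').
Proof.
move=> /andP[t0 t1] h h' i.
rewrite -add_col_mx -!scale_col_mx mulmxDr -!scalemxAr !mxE.
have := ler_wpM2l t0 (h i); rewrite -subr_ge0 in t1.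
by have := ler_wpM2l t1 (h' i); rewrite !mxE; lra.
Qed.

Lemma inZ0 : inZ G g 0 0.
Proof. by have [e e0 he] := inZ_ball; apply: he; rewrite normr0. Qed.

Lemma adm_eq0 : adm_eq A B G g lam 0 0.
Proof.
split; first by rewrite !mulmx0 addr0.
by exists 0, 0; rewrite !scaler0; split=> //; exact: inZ0.
Qed.

Lemma adm_eq_conv (t : R) x u x' u' : 0 <= t <= 1 ->
  adm_eq A B G g lam x u -> adm_eq A B G g lam x' u' ->
  adm_eq A B G g lam (t *: x + (1 - t) *: x') (t *: u + (1 - t) *: u').
Proof.
move=> t01 [eq [z [w [Z [zE wE]]]]] [eq' [z' [w' [Z' [zE' wE']]]]]; split.
  by rewrite !mulmxDr -!scalemxAr addrACA -!scalerDr -eq -eq'.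
exists (t *: z + (1 - t) *: z'), (t *: w + (1 - t) *: w'); split.
  exact: inZ_conv.
rewrite zE zE' wE wE' !scalerDr !scalerA.
by split; congr (_ *: _ + _ *: _); rewrite mulrC.
Qed.

Lemma inlamZ_margin : exists2 r, 0 < r & forall x u x' u',
  inlamZ G g lam x u -> `|x'| < r -> `|u'| < r -> inZ G g (x + x') (u + u').
Proof.
have [e e0 he] := inZ_ball; have [l0 l1] := andP hlam.
have l1' : 0 < 1 - lam by rewrite subr_gt0.
exists ((1 - lam) * e); first exact: mulr_gt0.
move=> x u x' u' [z [w [Z [-> ->]]]] xe ue.
have -> : x' = (1 - lam) *: ((1 - lam)^-1 *: x').
  by rewrite scalerA divff ?scale1r// gt_eqF.
have -> : u' = (1 - lam) *: ((1 - lam)^-1 *: u').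
  by rewrite scalerA divff ?scale1r// gt_eqF.
apply: inZ_conv => //; first by rewrite l0 ltW.
by apply: he; rewrite normrZ gtr0_norm ?invr_gt0// mulrC ltr_pdivrMr// mulrC.
Qed.

Hypothesis heq_uniq : forall x1 u1 x2 u2,
  adm_eq A B G g lam x1 u1 -> adm_eq A B G g lam x2 u2 ->
  C *m x1 + D *m u1 = C *m x2 + D *m u2 -> x1 = x2 /\ u1 = u2.

(* As [0] is interior to [Z], uniqueness of admissible equilibria propagates by
   scaling to the whole subspace of equilibria, so the output determines the
   equilibrium linearly. *)
Lemma equilibrium_of_output : exists L : 'M[R]_(n + m, p), forall x u,
  adm_eq A B G g lam x u -> col_mx x u = L *m (C *m x + D *m u).
Proof.
have [l0 _] := andP hlam.
have [lE|lN] := eqVneq lam 0.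
  exists 0 => x u [_ [z [w [_ [-> ->]]]]].
  by rewrite lE !scale0r mul0mx col_mx0.
have l0' : 0 < lam by rewrite lt_neqAle eq_sym lN.
pose F := col_mx (row_mx (1%:M - A) (- B)) (row_mx C D).
have FE (x : 'cV[R]_n) (u : 'cV[R]_m) :
    F *m col_mx x u = col_mx (x - (A *m x + B *m u)) (C *m x + D *m u).
  by rewrite /F mul_col_mx !mul_row_col mulmxBl mul1mx mulNmx opprD addrA.
have Finj (x : 'cV[R]_n) (u : 'cV[R]_m) : F *m col_mx x u = 0 -> col_mx x u = 0.
  rewrite FE => F0.
  have /eqP : usubmx (col_mx (x - (A *m x + B *m u)) (C *m x + D *m u)) = 0.
    by rewrite F0 linear0.
  rewrite col_mxKu subr_eq0 => /eqP eq.
  have out : C *m x + D *m u = 0.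
    by rewrite -[LHS](@col_mxKd _ n p 1 (x - (A *m x + B *m u))) F0 linear0.
  have [e e0 he] := inZ_ball.
  pose b := `|x| + `|u| + 1.
  have b0 : 0 < b by rewrite ltr_wpDl// addr_ge0.
  pose t := e / b; have t0 : 0 < t by rewrite divr_gt0.
  have adm : adm_eq A B G g lam (lam *: (t *: x)) (lam *: (t *: u)).
    split; first by rewrite -!scalemxAr -!scalerDr -eq.
    exists (t *: x), (t *: u); split=> //; apply: he;
      rewrite normrZ gtr0_norm// /t mulrAC ltr_pdivrMr// ltr_pM2l// /b.
      by have := normr_ge0 u; lra.
    by have := normr_ge0 x; lra.
  have [] := heq_uniq adm adm_eq0.
    by rewrite -!scalemxAr -!scalerDr out !scaler0 !mulmx0 addr0.
  move=> /eqP; rewrite scaler_eq0 (gt_eqF l0') scaler_eq0 (gt_eqF t0) /= => /eqP ->.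
  by move=> /eqP; rewrite scaler_eq0 (gt_eqF l0') scaler_eq0 (gt_eqF t0) /= => /eqP ->; rewrite col_mx0.
have /row_freeP[P FP] : row_free F^T.
  apply: inj_row_free => w wF.
  have : F *m w^T = 0 by rewrite -[F]trmxK -trmx_mul wF trmx0.
  rewrite -[w^T]vsubmxK => /Finj /(congr1 trmx).
  by rewrite vsubmxK trmxK trmx0.
exists (rsubmx P^T) => x u [eq _].
have PF : P^T *m F = 1%:M by rewrite -[F]trmxK -trmx_mul FP trmx1.
rewrite -[LHS]mul1mx -PF -mulmxA FE -eq subrr -[P^T in LHS]hsubmxK mul_row_col.
by rewrite mulmx0 add0r.
Qed.

Lemma Ysp_conv : convex_set1 (Ysp A B C D G g lam).
Proof.
move=> t _ _ t01 [x [u [a ->]]] [x' [u' [a' ->]]].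
exists (t *: x + (1 - t) *: x'), (t *: u + (1 - t) *: u').
split; first exact: adm_eq_conv.
by rewrite !mulmxDr -!scalemxAr !scalerDr addrACA.
Qed.

Lemma Ysp0 : Ysp A B C D G g lam 0.
Proof.
by exists 0, 0; split; [exact: adm_eq0 | rewrite !mulmx0 addr0].
Qed.

Lemma Ysp_closed : closed (Ysp A B C D G g lam).
Proof.
have [l0 _] := andP hlam.
have [lE|lN] := eqVneq lam 0.
  rewrite (_ : Ysp _ _ _ _ _ _ _ = [set y | 1%:M *m y = (0 : 'M[R]_p) *m y]).
    exact: closed_mulmx_eq.
  apply/seteqP; split=> y /=; rewrite mul1mx mul0mx; last by move=> ->; exact: Ysp0.
  move=> [x [u [[_ [z [w [_ [-> ->]]]]] ->]]].
  by rewrite lE !scale0r !mulmx0 addr0.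
have l0' : 0 < lam by rewrite lt_neqAle eq_sym lN.
have [L hL] := equilibrium_of_output.
pose M1 := usubmx L; pose M2 := A *m usubmx L + B *m dsubmx L.
pose M3 := C *m usubmx L + D *m dsubmx L.
have -> : Ysp A B C D G g lam =
  [set y | M1 *m y = M2 *m y] `&` ([set y | M3 *m y = 1%:M *m y] `&`
   [set y | forall i, (G *m (lam^-1 *: L) *m y) i 0 <= g i 0]).
  apply/seteqP; split=> y /=.
    move=> [x [u [a yE]]]; have := hL _ _ a; rewrite -yE => z.
    have xE : x = M1 *m y by rewrite /M1 mul_usub_mx -z col_mxKu.
    have uE : u = dsubmx L *m y by rewrite mul_dsub_mx -z col_mxKd.
    have [eq [x' [u' [Z [x'E u'E]]]]] := a.
    split; first by rewrite /M2 mulmxDl -!mulmxA -uE -/M1 -xE.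
    split; first by rewrite mul1mx /M3 mulmxDl -!mulmxA -uE -/M1 -xE.
    move=> i; have := Z i; congr (_ <= _); congr ((_ : 'cV[R]__) _ _).
    rewrite -mulmxA -scalemxAl -z x'E u'E -scale_col_mx scalerA mulVf// scale1r.
    by [].
  move=> [e1 [e2 e3]]; exists (M1 *m y), (dsubmx L *m y); split; last first.
    by rewrite !mulmxA -mulmxDl -/M3 e2 mul1mx.
  split; first by rewrite [LHS]e1 /M2 mulmxDl !mulmxA.
  exists (lam^-1 *: (M1 *m y)), (lam^-1 *: (dsubmx L *m y)).
  rewrite !scalerA divff// !scale1r; split=> // i; have := e3 i.
  by rewrite -scale_col_mx -mul_col_mx vsubmxK scalemxAl mulmxA.
apply: closedI; first exact: closed_mulmx_eq.
apply: closedI; first exact: closed_mulmx_eq.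
exact: closed_mulmx_le.
Qed.

End ReachableSetpoints.

Section OptimalControlProblem.
Variables (R : realType) (n m p q : nat).
Variables (A : 'M[R]_n) (B : 'M[R]_(n, m)) (C : 'M[R]_(p, n)) (D : 'M[R]_(p, m)).
Variables (G : 'M[R]_(q, n + m)) (g : 'cV[R]_q) (lam : R).
Variables (Qh : 'M[R]_n) (Rw : 'M[R]_m) (VO : 'cV[R]_p -> 'cV[R]_p -> R) (N : nat).
Hypothesis hlam : 0 <= lam < 1.
Hypothesis hZint : interior (Zset G g) (0 : 'cV[R]_(n + m)).
Local Notation Q := (Qh *m Qh).
Local Notation feasible := (mpc_feasible A B G g lam).
Local Notation cost := (mpc_cost A B C D Q Rw VO).
Local Notation optimal := (mpc_optimal A B C D G g lam Q Rw VO).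

Lemma mpc_near_equilibrium (nc : nat) : \rank (ctrb_mx A B nc) = n -> (nc <= N)%N ->
  exists r c, [/\ 0 < r, 0 < c & forall ysp x xs us, adm_eq A B G g lam xs us ->
    `|x - xs| < r -> exists u, feasible N x u xs us /\
      cost N x ysp u xs us <= c * `|x - xs| ^+ 2 + VO (C *m xs + D *m us) ysp].
Proof.
move=> rk ncN.
have [c0 c00 hc] := steering rk ncN.
have [r0 r00 hr] := inlamZ_margin hlam hZint.
pose d := (n%:R ^+ 2 * `|Q| + m%:R ^+ 2 * `|Rw|) * c0 ^+ 2.
have d0 : 0 <= d by rewrite mulr_ge0 ?sqr_ge0// addr_ge0// mulr_ge0// sqr_ge0.
exists (r0 / c0), (N%:R * d + 1); split; [exact: divr_gt0| |].
  by rewrite ltr_wpDl// mulr_ge0.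
move=> ysp x xs us [eq adm] xr; have [v [vN hv]] := hc (x - xs).
pose u j := us + v j.
have uE : (fun j => u j - us) = v by apply/funext => j; rewrite /u addrC addKr.
have xE j : xpred A B x u j - xs = xpred A B (x - xs) v j.
  by rewrite -uE xpred_error.
have ce : c0 * `|x - xs| < r0 by rewrite mulrC -ltr_pdivlMr.
exists u; split; first split.
- move=> j jN; have [h1 h2] := hv j jN.
  have -> : xpred A B x u j = xs + xpred A B (x - xs) v j by rewrite -xE addrC subrK.
  by apply: hr => //; [exact: le_lt_trans h1 _|exact: le_lt_trans h2 _].
- by split=> //; apply/eqP; rewrite -subr_eq0 xE vN.
rewrite /mpc_cost lerD2r.
apply: (@le_trans _ _ (\sum_(j < N) d * `|x - xs| ^+ 2)); last first.
  rewrite sumr_const card_ord -[leLHS]mulr_natl mulrA ler_wpM2r ?sqr_ge0//.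
  by rewrite lerDl.
apply: ler_sum => j _; have [h1 h2] := hv j (ltn_ord j).
have sq z : 0 <= z -> z <= c0 * `|x - xs| -> z ^+ 2 <= c0 ^+ 2 * `|x - xs| ^+ 2.
  by move=> z0 zc; rewrite -exprMn ler_sqr ?nnegrE// mulr_ge0// ltW.
rewrite /d -mulrA mulrDl; apply: lerD.
  rewrite xE (le_trans (qform_le _ _))// ler_wpM2l ?mulr_ge0 ?sqr_ge0//.
  exact: sq.
have -> : u j - us = v j by rewrite -uE.
rewrite (le_trans (qform_le _ _))// ler_wpM2l ?mulr_ge0 ?sqr_ge0//.
exact: sq.
Qed.

Hypothesis Qs : Qh^T = Qh.
Hypothesis obs : observable Qh A.
Hypothesis Rpd : posdef_mx Rw.

Lemma mpc_cost_lower : exists2 c, 0 < c & forall ysp x u xa ua,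
  feasible N x u xa ua ->
  `|x - xa| ^+ 2 <= c * (cost N x ysp u xa ua - VO (C *m xa + D *m ua) ysp).
Proof.
have [c c0 hc] := open_loop_coercive B N Qs obs Rpd.
exists c => // ysp x u xa ua [_ [[eq _] xN]].
have eN : xpred A B (x - xa) (fun j => u j - ua) N = 0.
  by rewrite xpred_error// xN subrr.
rewrite (le_trans (hc _ _ eN))// /mpc_cost addrK ler_wpM2l ?(ltW c0)//.
by apply: ler_sum => j _; rewrite xpred_error.
Qed.

Hypothesis VOconv : convex2 VO.

Lemma mpc_feasible_mid x u xa ua u' xa' ua' :
  feasible N x u xa ua -> feasible N x u' xa' ua' ->
  feasible N x (fun j => 2^-1 *: u j + 2^-1 *: u' j)
    (2^-1 *: xa + 2^-1 *: xa') (2^-1 *: ua + 2^-1 *: ua').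
Proof.
have half : 1 - 2^-1 = 2^-1 :> R by field.
have h01 : 0 <= (2^-1 : R) <= 1 by apply/andP; split; lra.
have xx : x = 2^-1 *: x + 2^-1 *: x by exact/esym/scaler_halves.
move=> [Z [a xN]] [Z' [a' xN']]; split; last split.
- move=> j jN; rewrite {1}xx xpred_lin.
  by have := inZ_conv h01 (Z j jN) (Z' j jN); rewrite half.
- by have := adm_eq_conv h01 a a'; rewrite half.
- by rewrite {1}xx xpred_lin xN xN'.
Qed.

(* Evaluate the cost at the midpoint of the two feasible points. *)
Lemma mpc_optimal_dist : exists2 c, 0 < c & forall ysp x u xa ua u' xa' ua',
  optimal N x ysp u xa ua -> feasible N x u' xa' ua' ->
  `|xa' - xa| ^+ 2 <= c * (cost N x ysp u' xa' ua' - cost N x ysp u xa ua).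
Proof.
have [c c0 hc] := open_loop_coercive B N Qs obs Rpd.
exists (2 * c) => [|ysp x u xa ua u' xa' ua' [fe opt] fe']; first by rewrite mulr_gt0.
have half : 1 - 2^-1 = 2^-1 :> R by field.
have h01 : 0 <= (2^-1 : R) <= 1 by apply/andP; split; lra.
have := opt _ _ _ (mpc_feasible_mid fe fe').
have xx : x = 2^-1 *: x + 2^-1 *: x by exact/esym/scaler_halves.
set um := fun j => _.
have [_ [[eq _] xN]] := fe; have [_ [[eq' _] xN']] := fe'.
pose e j := xpred A B x u j - xa; pose e' j := xpred A B x u' j - xa'.
pose v j := u j - ua; pose v' j := u' j - ua'.
have dE j : e j - e' j = xpred A B (xa' - xa) (fun j => v j - v' j) j.
  rewrite /e /e' -(xpred_error x u j eq) -(xpred_error x u' j eq') -/v -/v'.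
  have := xpred_lin A B 1 (-1) (x - xa) (x - xa') v v' j.
  rewrite !scale1r !scaleN1r => <-.
  have -> : x - xa - (x - xa') = xa' - xa by rewrite opprB addrC addrA subrK.
  by congr (xpred _ _ _ _ _); apply/funext => i; rewrite scale1r scaleN1r.
have dN : xpred A B (xa' - xa) (fun j => v j - v' j) N = 0.
  by rewrite -dE /e /e' xN xN' !subrr.
have := hc _ _ dN; set S := \sum_(j < N) _ => hS.
have -> : cost N x ysp um (2^-1 *: xa + 2^-1 *: xa') (2^-1 *: ua + 2^-1 *: ua') =
   2^-1 * (\sum_(j < N) (qform Q (e j) + qform Rw (v j))
         + \sum_(j < N) (qform Q (e' j) + qform Rw (v' j))) - 4^-1 * S
   + VO (C *m (2^-1 *: xa + 2^-1 *: xa') + D *m (2^-1 *: ua + 2^-1 *: ua')) ysp.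
  rewrite /mpc_cost; congr (_ + _).
  rewrite -big_split /= /S !mulr_sumr -sumrB; apply: eq_bigr => j _.
  have -> : xpred A B x um j - (2^-1 *: xa + 2^-1 *: xa') =
            2^-1 *: e j + 2^-1 *: e' j.
    by rewrite {1}xx /um xpred_lin /e /e' !scalerBr opprD addrACA.
  have -> : um j - (2^-1 *: ua + 2^-1 *: ua') = 2^-1 *: v j + 2^-1 *: v' j.
    by rewrite /um /v /v' !scalerBr opprD addrACA.
  by rewrite !qform_mid -dE; ring.
rewrite /mpc_cost -/(e _) -/(v _).
have := @VOconv 2^-1 (C *m xa + D *m ua) ysp (C *m xa' + D *m ua') ysp h01.
rewrite half scaler_halves.
have -> : 2^-1 *: (C *m xa + D *m ua) + 2^-1 *: (C *m xa' + D *m ua') =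
  C *m (2^-1 *: xa + 2^-1 *: xa') + D *m (2^-1 *: ua + 2^-1 *: ua').
  by rewrite !mulmxDr -!scalemxAr !scalerDr addrACA.
set so := \sum_(j < N) _; set ss := \sum_(j < N) _.
set a := VO _ _; set a1 := VO _ _; set a2 := VO _ _ => h1 h2.
have h3 : S <= 2 * (ss + a2 - (so + a1)) by lra.
by rewrite (le_trans hS)// -mulrA mulrCA ler_wpM2l// ltW.
Qed.

End OptimalControlProblem.

Section Shift.
Variables (R : realType) (n m p q : nat).
Variables (A : 'M[R]_n) (B : 'M[R]_(n, m)) (C : 'M[R]_(p, n)) (D : 'M[R]_(p, m)).
Variables (G : 'M[R]_(q, n + m)) (g : 'cV[R]_q) (lam : R).
Variables (Q : 'M[R]_n) (Rw : 'M[R]_m) (VO : 'cV[R]_p -> 'cV[R]_p -> R) (N : nat).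
Hypothesis hlam : 0 <= lam < 1.
Hypothesis hZint : interior (Zset G g) (0 : 'cV[R]_(n + m)).

Lemma mpc_shift ysp x u xa ua : (0 < N)%N -> mpc_feasible A B G g lam N x u xa ua ->
  exists u', mpc_feasible A B G g lam N (A *m x + B *m u 0%N) u' xa ua /\
    mpc_cost A B C D Q Rw VO N (A *m x + B *m u 0%N) ysp u' xa ua =
    mpc_cost A B C D Q Rw VO N x ysp u xa ua
      - (qform Q (x - xa) + qform Rw (u 0%N - ua)).
Proof.
case: N => [//|k] _ [Z [[eq adm] xN]].
pose u' j := if (j < k)%N then u j.+1 else ua.
have xE j : (j <= k)%N ->
    xpred A B (A *m x + B *m u 0%N) u' j = xpred A B x u j.+1.
  move=> jk; rewrite -xpred_shift; apply: eq_xpred => i ij.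
  by rewrite /u' (leq_trans ij jk).
have u'k : u' k = ua by rewrite /u' ltnn.
have [r r0 hr] := inlamZ_margin hlam hZint.
exists u'; split; first split.
- move=> j; rewrite ltnS leq_eqVlt => /orP[/eqP ->|jk].
    rewrite xE// u'k xN; have := hr xa ua 0 0 adm.
    by rewrite !addr0; apply; rewrite normr0.
  by rewrite xE ?(ltnW jk)// /u' jk; apply: Z.
- by split=> //; rewrite [LHS]/= xE// xN u'k -eq.
rewrite /mpc_cost big_ord_recr [X in _ = X + _ - _]big_ord_recl /=.
rewrite xE// xN u'k !subrr.
have q0 l (M : 'M[R]_l) : qform M 0 = 0 by rewrite /qform mulmx0 mxE.
rewrite !q0 !addr0; move: (qform Q (x - xa) + _) => f0.
rewrite [RHS]addrC !addrA addNr add0r; congr (_ + _); apply: eq_bigr => j _.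
by rewrite xE ?(ltnW (ltn_ord j))// /u' ltn_ord.
Qed.

End Shift.

Section VanishingSequences.
Variable R : realType.

Lemma sqr_lt_sqr (a b : R) : 0 < b -> a ^+ 2 < b ^+ 2 -> a < b.
Proof. by move=> b0 h; rewrite ltNge; apply/negP => ba; nra. Qed.

Definition vanishes (a : nat -> R) :=
  forall eps, 0 < eps -> exists K, forall k, (K <= k)%N -> a k < eps.

Lemma vanishes_le (a b : nat -> R) (c : R) : 0 < c ->
  (forall k, a k <= c * b k) -> vanishes b -> vanishes a.
Proof.
move=> c0 ab vb eps e0; have [K hK] := vb _ (divr_gt0 e0 c0).
exists K => k Kk; rewrite (le_lt_trans (ab k))// mulrC -ltr_pdivlMr//.
exact: hK.
Qed.

Lemma vanishes_sqr (a : nat -> R) : vanishes (fun k => a k ^+ 2) -> vanishes a.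
Proof.
move=> va eps e0; have [K hK] := va _ (exprn_gt0 2 e0).
by exists K => k Kk; apply: sqr_lt_sqr => //; exact: hK.
Qed.

Lemma vanishesD (a b : nat -> R) :
  vanishes a -> vanishes b -> vanishes (fun k => a k + b k).
Proof.
move=> va vb eps e0; have e2 : 0 < eps / 2 by rewrite divr_gt0.
have [K hK] := va _ e2; have [L hL] := vb _ e2.
exists (maxn K L) => k; rewrite geq_max => /andP[Kk Lk].
have := hK k Kk; have := hL k Lk; lra.
Qed.

Lemma vanishes_shift (a : nat -> R) j :
  vanishes a -> vanishes (fun k => a (k + j)%N).
Proof.
move=> va eps e0; have [K hK] := va _ e0.
by exists K => k Kk; apply: hK; rewrite (leq_trans Kk)// leq_addr.
Qed.

Lemma vanishes_sum (a : nat -> nat -> R) l :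
  (forall j, vanishes (a j)) -> vanishes (fun k => \sum_(j < l) a j k).
Proof.
move=> va; elim: l => [|l IH].
  by move=> eps e0; exists 0%N => k _; rewrite big_ord0.
move=> eps e0; have [K hK] := vanishesD IH (va l) e0.
by exists K => k Kk; rewrite big_ord_recr /=; exact: hK.
Qed.

Lemma vanishes_cvg (l : nat) (z : nat -> 'cV[R]_l) (w : 'cV[R]_l) :
  vanishes (fun k => `|z k - w|) -> z @ \oo --> w.
Proof.
move=> va; apply/(@cvgrPdist_lt R _ _ \oo _ z w) => eps e0.
have [K hK] := va _ e0.
by exists K => // k /= Kk; rewrite distrC; exact: hK.
Qed.

End VanishingSequences.

Section TrackingLyapunov.
Variables (R : realType) (n m p : nat).
Variables (A : 'M[R]_n) (B : 'M[R]_(n, m)) (C : 'M[R]_(p, n)) (D : 'M[R]_(p, m)).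
Variables (Qh : 'M[R]_n) (kappa : 'cV[R]_n -> 'cV[R]_m) (X : set 'cV[R]_n).
Variables (V W : 'cV[R]_n -> R) (Xa : 'cV[R]_n -> 'cV[R]_n) (Ua : 'cV[R]_n -> 'cV[R]_m).
Variables (xt : 'cV[R]_n) (ut : 'cV[R]_m).
Let next x := A *m x + B *m kappa x.
Hypothesis obs : observable Qh A.
Hypothesis Xnext : forall x, X x -> X (next x).
Hypothesis Xa_eq : forall x, X x -> Xa x = A *m Xa x + B *m Ua x.
Hypothesis W_ge0 : forall x, X x -> 0 <= W x.
Hypothesis W_le : forall x, X x -> W x <= V x.
Hypothesis decrease : exists2 c, 0 < c & forall x, X x ->
  [/\ `|Qh *m (x - Xa x)| ^+ 2 <= c * (V x - V (next x)),
      `|kappa x - Ua x| ^+ 2 <= c * (V x - V (next x)) &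
      `|Xa x - Xa (next x)| ^+ 2 <= c * (V x - V (next x))].
Hypothesis lower : exists2 c, 0 < c & forall x, X x -> `|x - Xa x| ^+ 2 <= c * V x.
Hypothesis upper : exists r c, [/\ 0 < r, 0 < c &
  forall x, X x -> `|x - xt| < r -> V x <= c * `|x - xt| ^+ 2].
Hypothesis retarget : exists r c, [/\ 0 < r, 0 < c &
  forall x b, X x -> 0 <= b <= 1 -> `|x - Xa x + b *: (Xa x - xt)| < r ->
    b * W x <= c * `|x - Xa x + b *: (Xa x - xt)| ^+ 2].
Hypothesis sharp : forall eps, 0 < eps -> exists2 eta, 0 < eta &
  forall x, X x -> W x < eta -> `|Xa x - xt| < eps /\ `|Ua x - ut| < eps.
Hypothesis bounded : forall b, exists M, forall x, X x -> W x <= b -> `|Xa x - xt| <= M.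

Local Notation traj := (cl_traj A B kappa).

Lemma traj_inv x0 k : X x0 -> X (traj x0 k).
Proof. by move=> Xx0; elim: k => [//|k IH]; exact: Xnext. Qed.

Lemma V_next x : X x -> V (next x) <= V x.
Proof.
move=> Xx; have [c c0 hc] := decrease; have [h _ _] := hc x Xx.
by rewrite -subr_ge0 -(pmulr_rge0 _ c0) (le_trans _ h)// sqr_ge0.
Qed.

Lemma V_traj x0 k : X x0 -> V (traj x0 k) <= V x0.
Proof.
move=> Xx0; elim: k => [//|k IH]; rewrite (le_trans _ IH)//.
exact/V_next/traj_inv.
Qed.

Lemma tracking_stable : cl_stable A B kappa X xt.
Proof.
move=> eps e0.
have [c c0 hc] := lower; have [r [d [r0 d0 hd]]] := upper.
have e2 : 0 < eps / 2 by rewrite divr_gt0.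
have [eta eta0 he] := sharp e2.
pose h := Num.min eta ((eps / 2) ^+ 2 / c).
have h0 : 0 < h by rewrite lt_min eta0 divr_gt0// exprn_gt0.
pose del := Num.min r (Num.min 1 (h / d)).
exists del; split; first by rewrite !lt_min r0 ltr01 divr_gt0.
move=> x0 Xx0; rewrite !lt_min => /and3P[xr x1 xh] k.
have Vh : V x0 < h.
  rewrite (le_lt_trans (hd _ Xx0 xr))// mulrC -ltr_pdivlMr//.
  rewrite (le_lt_trans _ xh)// expr2 -[leRHS]mulr1 ler_wpM2l// ltW//.
have := le_lt_trans (V_traj k Xx0) Vh; have := traj_inv k Xx0.
move: (traj x0 k) => x Xx; rewrite lt_min => /andP[V1 V2].
have [h1 _] := he x Xx (le_lt_trans (W_le Xx) V1).
have h2 : `|x - Xa x| < eps / 2.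
  apply: sqr_lt_sqr => //; rewrite (le_lt_trans (hc x Xx))//.
  by rewrite mulrC -ltr_pdivlMr.
have := ler_normD (x - Xa x) (Xa x - xt); rewrite addrA subrK; lra.
Qed.

Section Trajectory.
Variable x0 : 'cV[R]_n.
Hypothesis Xx0 : X x0.
Let x k := traj x0 k.
Let E k := x k - Xa (x k).

Let Xx k : X (x k). Proof. exact: traj_inv. Qed.

Lemma V_diff_vanishes : vanishes (fun k => V (x k) - V (x k.+1)).
Proof.
have cv : cvgn (fun k => V (x k)).
  apply: nonincreasing_is_cvgn.
    by apply/nonincreasing_seqP => k; exact/V_next/Xx.
  by exists 0 => _ [k _ <-]; rewrite (le_trans (W_ge0 (Xx k)))// W_le.
move=> eps e0; have e2 : 0 < eps / 2 by rewrite divr_gt0.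
have /cvgrPdist_lt/(_ _ e2)[K _ hK] := cv.
exists K => k Kk; have := hK k Kk; have := hK k.+1 (leqW Kk) => /=.
by rewrite !ltr_norml => /andP[? ?] /andP[? ?]; lra.
Qed.

Let decr_vanishes (a : nat -> R) c : 0 < c ->
  (forall k, a k ^+ 2 <= c * (V (x k) - V (x k.+1))) -> vanishes a.
Proof. by move=> c0 h; apply/vanishes_sqr/(vanishes_le c0 h)/V_diff_vanishes. Qed.

Lemma input_vanishes : vanishes (fun k => `|kappa (x k) - Ua (x k)|).
Proof.
have [c c0 hc] := decrease; apply: (decr_vanishes c0) => k.
by have [] := hc _ (Xx k).
Qed.

Lemma tracking_error_vanishes : vanishes (fun k => `|E k|).
Proof.
have [c c0 hc] := decrease; have [d d0 hd] := observable_bound obs.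
pose S k := \sum_(j < n) (`|Qh *m E (k + j)%N| + `|E (k + j).+1 - A *m E (k + j)%N|).
apply: (@vanishes_le _ _ S d) => // [k|].
  have := hd (fun j => E (k + j)%N); rewrite addn0 => /le_trans; apply.
  by rewrite ler_wpM2l ?(ltW d0)//; apply: ler_sum => j _; rewrite addnS.
apply: (@vanishes_sum _ (fun j k => `|Qh *m E (k + j)%N| + `|E (k + j).+1 - A *m E (k + j)%N|)).
move=> j; apply: (@vanishes_shift _ (fun k => `|Qh *m E k| + `|E k.+1 - A *m E k|)).
apply: vanishesD.
  by apply: (decr_vanishes c0) => k; have [] := hc _ (Xx k).
pose b := m%:R * `|B| + 1; have b0 : 0 < b by rewrite ltr_wpDl// mulr_ge0.
apply: (@vanishes_le _ _ (fun k => `|kappa (x k) - Ua (x k)| + `|Xa (x k) - Xa (x k.+1)|) b) => //.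
  move=> k.
  have -> : E k.+1 - A *m E k = B *m (kappa (x k) - Ua (x k)) + (Xa (x k) - Xa (x k.+1)).
    rewrite /E mulmxBr mulmxBr {1}/x /= -/(x k) [X in _ = _ + (X - _)](Xa_eq (Xx k)).
    rewrite -/(next (x k)) -/(x k.+1).
    by rewrite /next; apply/matrixP => i l; rewrite !mxE; ring.
  rewrite (le_trans (ler_normD _ _))// mulrDr; apply: lerD.
    rewrite (le_trans (mulmx_norm_le _ _))// ler_wpM2r// /b; lra.
  by rewrite -[leLHS]mul1r ler_wpM2r// /b lerDr mulr_ge0.
apply: vanishesD; first exact: input_vanishes.
by apply: (decr_vanishes c0) => k; have [] := hc _ (Xx k).
Qed.

(* Were [W] to stay above [eta], moving the reference a fraction [b] towards the
   target would gain [b * W] at a price of order [b ^ 2 + |E| ^ 2]. *)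
Lemma W_vanishes : vanishes (fun k => W (x k)).
Proof.
move=> eta eta0.
have [r [c [r0 c0 hr]]] := retarget.
have [M0 hM0] := bounded (V x0).
pose M := `|M0| + 1; have M1 : 0 < M by rewrite ltr_wpDl.
have hM k : `|Xa (x k) - xt| <= M.
  have Wk : W (x k) <= V x0 by rewrite (le_trans (W_le (Xx k)))// V_traj.
  by rewrite (le_trans (hM0 _ (Xx k) Wk))// (le_trans (ler_norm _))// lerDl.
pose b := Num.min 1 (Num.min (r / (4 * M)) (eta / (8 * c * M ^+ 2))).
have M2 : 0 < M ^+ 2 by rewrite exprn_gt0.
have b0 : 0 < b by rewrite !lt_min ltr01 !divr_gt0// !mulr_gt0.
have b1 : b <= 1 by rewrite ge_min lexx.
have bM : b * M <= r / 4.
  have : b <= r / (4 * M) by rewrite !ge_min lexx orbT.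
  rewrite ler_pdivlMr ?mulr_gt0// => h; lra.
have bc : 8 * c * M ^+ 2 * b <= eta.
  have : b <= eta / (8 * c * M ^+ 2) by rewrite !ge_min lexx !orbT.
  by rewrite ler_pdivlMr ?mulr_gt0// mulrC.
pose s := Num.min (r / 4) (b * M).
have s0 : 0 < s by rewrite lt_min divr_gt0// mulr_gt0.
have [K hK] := tracking_error_vanishes s0.
exists K => k Kk; have := hK k Kk; rewrite lt_min => /andP[Er EM].
have tri := ler_normD (E k) (b *: (Xa (x k) - xt)).
rewrite normrZ (gtr0_norm b0) in tri.
have bX : b * `|Xa (x k) - xt| <= b * M by rewrite ler_wpM2l// ltW.
have zr : `|E k + b *: (Xa (x k) - xt)| < r by lra.
have b01 : 0 <= b <= 1 by rewrite (ltW b0).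
have := hr (x k) b (Xx k) b01 zr; rewrite -/(E k).
set z := `|E k + _| in tri zr *.
have z2 : z < 2 * (b * M) by lra.
have zz : z ^+ 2 < (2 * (b * M)) ^+ 2.
  by rewrite ltr_pXn2r// nnegrE ?normr_ge0// mulr_ge0// mulr_ge0// ltW.
have : c * z ^+ 2 < c * (2 * (b * M)) ^+ 2 by rewrite ltr_pM2l.
have -> : c * (2 * (b * M)) ^+ 2 = b * (4 * c * M ^+ 2 * b) by ring.
move=> h1 h2; have := le_lt_trans h2 h1; rewrite ltr_pM2l//.
lra.
Qed.

Lemma reference_vanishes :
  vanishes (fun k => `|Xa (x k) - xt|) /\ vanishes (fun k => `|Ua (x k) - ut|).
Proof.
split=> eps e0; have [eta eta0 he] := sharp e0; have [K hK] := W_vanishes eta0;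
  by exists K => k Kk; have [] := he _ (Xx k) (hK k Kk).
Qed.

Lemma tracking_converges : cl_converges A B C D kappa x0 xt ut (C *m xt + D *m ut).
Proof.
have [vX vU] := reference_vanishes.
have cx : (fun k => x k) @ \oo --> xt.
  apply: vanishes_cvg; have := vanishesD tracking_error_vanishes vX.
  apply: (@vanishes_le _ _ _ 1) => // k; rewrite mul1r (le_trans _ (ler_normD _ _))//.
  by rewrite /E addrA subrK.
have cu : (fun k => kappa (x k)) @ \oo --> ut.
  apply: vanishes_cvg; have := vanishesD input_vanishes vU.
  apply: (@vanishes_le _ _ _ 1) => // k; rewrite mul1r (le_trans _ (ler_normD _ _))//.
  by rewrite addrA subrK.
split=> //; split=> //; apply: cvgD.
  apply: (@cvg_comp _ _ _ x (mulmx C) _ _ _ cx); exact: mulmxl_continuous.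
apply: (@cvg_comp _ _ _ (fun k => kappa (x k)) (mulmx D) _ _ _ cu).
exact: mulmxl_continuous.
Qed.

End Trajectory.
End TrackingLyapunov.

Section ClosedLoop.
Variables (R : realType) (n m p q : nat).
Variables (A : 'M[R]_n) (B : 'M[R]_(n, m)) (C : 'M[R]_(p, n)) (D : 'M[R]_(p, m)).
Variables (G : 'M[R]_(q, n + m)) (g : 'cV[R]_q) (lam : R).
Variables (Qh : 'M[R]_n) (Rw : 'M[R]_m) (VO : 'cV[R]_p -> 'cV[R]_p -> R) (nc N : nat).
Variables (ysp : 'cV[R]_p) (kappa : 'cV[R]_n -> 'cV[R]_m).
Local Notation Q := (Qh *m Qh).
Local Notation XN := (XN A B G g lam N).
Local Notation adm := (adm_eq A B G g lam).
Local Notation Y := (Ysp A B C D G g lam).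
Local Notation next x := (A *m x + B *m kappa x).
Hypothesis hlam : 0 <= lam < 1.
Hypothesis hZint : interior (Zset G g) (0 : 'cV[R]_(n + m)).
Hypothesis N_gt0 : (0 < N)%N.
Hypothesis hkappa : is_mpc_law A B C D G g lam Q Rw VO N ysp kappa.

Lemma XN_next x : XN x -> XN (next x).
Proof.
move=> /hkappa[u [xa [ua [[fe _] <-]]]].
have [u' [fe' _]] := mpc_shift C D Q Rw VO hlam hZint ysp N_gt0 fe.
by exists u', xa, ua.
Qed.

Lemma kappa_inZ x : XN x -> inZ G g x (kappa x).
Proof. by move=> /hkappa[u [xa [ua [[[Z _] _] <-]]]]; exact: (Z 0%N). Qed.

Hypothesis Qs : Qh^T = Qh.
Hypothesis obs : observable Qh A.
Hypothesis Rpd : posdef_mx Rw.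
Hypothesis rk : \rank (ctrb_mx A B nc) = n.
Hypothesis ncN : (nc <= N)%N.
Hypothesis VOconv : convex2 VO.
Hypothesis VOsub : subdiff2 VO.
Hypothesis VO_ge0 : forall y ys, 0 <= VO y ys.
Hypothesis heq_uniq : forall x1 u1 x2 u2, adm x1 u1 -> adm x2 u2 ->
  C *m x1 + D *m u1 = C *m x2 + D *m u2 -> x1 = x2 /\ u1 = u2.

Lemma VO_subdiff1 : subdiff1 (VO ^~ ysp).
Proof.
move=> y; have [s1 [s2 hs]] := VOsub y ysp; exists s1 => y'.
by have := hs y' ysp; rewrite subrr mulmx0 [X in _ + _ + X]mxE addr0.
Qed.

Lemma VO_convex1 : convex1 (VO ^~ ysp).
Proof.
move=> t y y' t01; have := @VOconv t y ysp y' ysp t01.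
by rewrite -scalerDl addrCA subrr addr0 scale1r.
Qed.

Variables (xt : 'cV[R]_n) (ut : 'cV[R]_m).
Let yt := C *m xt + D *m ut.
Hypothesis adm_t : adm xt ut.
Hypothesis yt_min : forall y, Y y -> VO yt ysp <= VO y ysp.
Hypothesis yt_uniq : forall y, Y y -> VO y ysp <= VO yt ysp -> y = yt.

Lemma mpc_tracks_target : cl_stable A B kappa XN xt /\
  forall x0, XN x0 -> cl_converges A B C D kappa x0 xt ut yt.
Proof.
have /choice[sol hsol] : forall x, exists s : (nat -> 'cV[R]_m) * 'cV[R]_n * 'cV[R]_m,
    XN x -> mpc_optimal A B C D G g lam Q Rw VO N x ysp s.1.1 s.1.2 s.2 /\
            s.1.1 0%N = kappa x.
  move=> x; have [Xx|nX] := pselect (XN x); last by exists (fun=> 0, 0, 0).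
  by have [u [xa [ua h]]] := hkappa Xx; exists (u, xa, ua).
pose U x := (sol x).1.1; pose Xa x := (sol x).1.2; pose Ua x := (sol x).2.
pose ya x := C *m Xa x + D *m Ua x.
pose V0 x := mpc_cost A B C D Q Rw VO N x ysp (U x) (Xa x) (Ua x).
pose V x := V0 x - VO yt ysp; pose W x := VO (ya x) ysp - VO yt ysp.
have opt x : XN x -> mpc_optimal A B C D G g lam Q Rw VO N x ysp (U x) (Xa x) (Ua x).
  by move=> /hsol[].
have U0 x : XN x -> U x 0%N = kappa x by move=> /hsol[].
have fe x : XN x -> mpc_feasible A B G g lam N x (U x) (Xa x) (Ua x).
  by move=> /opt[].
have admX x : XN x -> adm (Xa x) (Ua x) by move=> /fe[_ []].
have Yya x : XN x -> Y (ya x) by move=> Xx; exists (Xa x), (Ua x); split=> //; exact: admX.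
have Q0 w : 0 <= qform Q w by rewrite (le_trans _ (qform_sqr _ Qs))// sqr_ge0.
have [cR cR0 hcR] := posdef_lower Rpd.
have R0 w : 0 <= qform Rw w.
  by rewrite -(pmulr_rge0 _ cR0) (le_trans _ (hcR w))// sqr_ge0.
have [L hL] := equilibrium_of_output hlam hZint heq_uniq.
pose cL := p%:R * `|L| + 1; have cL0 : 0 < cL by rewrite ltr_wpDl// mulr_ge0.
have lip x : XN x -> `|Xa x - xt| <= cL * `|ya x - yt| /\ `|Ua x - ut| <= cL * `|ya x - yt|.
  move=> Xx; have E : col_mx (Xa x - xt) (Ua x - ut) = L *m (ya x - yt).
    by rewrite mulmxBr -(hL _ _ (admX _ Xx)) -(hL _ _ adm_t) opp_col_mx add_col_mx.
  have b : `|L *m (ya x - yt)| <= cL * `|ya x - yt|.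
    by rewrite (le_trans (mulmx_norm_le _ _))// ler_wpM2r// lerDl.
  have := usubmx_norm_le (col_mx (Xa x - xt) (Ua x - ut)).
  have := dsubmx_norm_le (col_mx (Xa x - xt) (Ua x - ut)).
  by rewrite col_mxKu col_mxKd E => h1 h2; split; apply: le_trans b.
have growth eps : 0 < eps -> exists2 eta, 0 < eta & forall x, XN x ->
    eps <= `|ya x - yt| -> eta * `|ya x - yt| <= W x.
  move=> e0; have Yt : Y yt by exists xt, ut.
  have [eta eta0 he] := convex_linear_growth
    (Ysp_closed hlam hZint heq_uniq) (@Ysp_conv _ _ _ _ _ A B C D G g lam)
    (fun y => VO_ge0 y ysp) VO_subdiff1 VO_convex1 Yt yt_uniq e0.
  by exists eta => // x Xx; apply: he; exact: Yya.
have W_ge0 x : XN x -> 0 <= W x by move=> Xx; rewrite subr_ge0 yt_min//; exact: Yya.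
have W_le x : XN x -> W x <= V x.
  move=> Xx; rewrite lerD2r lerDr sumr_ge0// => j _.
  by rewrite addr_ge0.
have dec : exists2 c, 0 < c & forall x, XN x ->
  [/\ `|Qh *m (x - Xa x)| ^+ 2 <= c * (V x - V (next x)),
      `|kappa x - Ua x| ^+ 2 <= c * (V x - V (next x)) &
      `|Xa x - Xa (next x)| ^+ 2 <= c * (V x - V (next x))].
  have [c c0 hc] := mpc_optimal_dist B C D G g lam N Qs obs Rpd VOconv.
  exists (1 + cR + c) => [|x Xx]; first by rewrite !addr_gt0.
  have Xn := XN_next Xx.
  have [u' [fe']] := mpc_shift C D Q Rw VO hlam hZint ysp N_gt0 (fe _ Xx).
  rewrite U0// in fe' *; rewrite -/(V0 x) => E.
  have := hc _ _ _ _ _ _ _ _ (opt _ Xn) fe'; rewrite -/(V0 _) E => h3.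
  have h1 := qform_sqr (x - Xa x) Qs; have h2 := hcR (kappa x - Ua x).
  have q1 := Q0 (x - Xa x); have q2 := R0 (kappa x - Ua x).
  have d1 : qform Q (x - Xa x) + qform Rw (kappa x - Ua x) <= V x - V (next x).
    have [_ /(_ _ _ _ fe')] := opt _ Xn; rewrite -/(V0 _) E /V; lra.
  have -> : V x - V (next x) = V0 x - V0 (next x) by rewrite /V; lra.
  have {}d1 : qform Q (x - Xa x) + qform Rw (kappa x - Ua x) <= V0 x - V0 (next x).
    by move: d1; rewrite /V; lra.
  set d := V0 x - V0 (next x) in d1 *.
  have h3' : `|Xa x - Xa (next x)| ^+ 2 <= c * d.
    by rewrite (le_trans h3)// ler_wpM2l ?(ltW c0)// /d; lra.
  have d0 : 0 <= d by lra.
  have cd : 0 <= c * d by rewrite mulr_ge0// ltW.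
  have cRd : 0 <= cR * d by rewrite mulr_ge0// ltW.
  have h2' : cR * qform Rw (kappa x - Ua x) <= cR * d.
    by rewrite ler_wpM2l ?(ltW cR0)//; lra.
  by split; lra.
have low : exists2 c, 0 < c & forall x, XN x -> `|x - Xa x| ^+ 2 <= c * V x.
  have [c c0 hc] := mpc_cost_lower B C D G g lam VO N Qs obs Rpd.
  exists c => // x Xx; rewrite (le_trans (hc ysp _ _ _ _ (fe _ Xx)))//.
  rewrite ler_wpM2l ?(ltW c0)// -/(V0 x) lerD2l lerN2 yt_min//; exact: Yya.
have [r [c [r0 c0 hc]]] := mpc_near_equilibrium C D Qh Rw VO hlam hZint rk ncN.
have up : exists r c, [/\ 0 < r, 0 < c &
    forall x, XN x -> `|x - xt| < r -> V x <= c * `|x - xt| ^+ 2].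
  exists r, c; split=> // x Xx xr; have [u [fu hu]] := hc ysp x _ _ adm_t xr.
  have [_ /(_ _ _ _ fu)] := opt _ Xx; rewrite -/(V0 x) /V -/yt; move: hu; rewrite -/yt.
  lra.
have ret : exists r c, [/\ 0 < r, 0 < c &
  forall x b, XN x -> 0 <= b <= 1 -> `|x - Xa x + b *: (Xa x - xt)| < r ->
    b * W x <= c * `|x - Xa x + b *: (Xa x - xt)| ^+ 2].
  exists r, c; split=> // x b Xx b01.
  have a := adm_eq_conv b01 adm_t (admX _ Xx).
  have -> : x - Xa x + b *: (Xa x - xt) = x - (b *: xt + (1 - b) *: Xa x).
    by apply/matrixP => i j; rewrite !mxE; ring.
  move=> xr; have [u [fu hu]] := hc ysp x _ _ a xr.
  have [_ /(_ _ _ _ fu)] := opt _ Xx; rewrite -/(V0 x).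
  have := W_le _ Xx; have := VO_convex1 yt (ya x) b01.
  have -> : b *: yt + (1 - b) *: ya x = C *m (b *: xt + (1 - b) *: Xa x)
      + D *m (b *: ut + (1 - b) *: Ua x).
    by rewrite /yt /ya !mulmxDr -!scalemxAr !scalerDr addrACA.
  rewrite /V /W; lra.
have sharp eps : 0 < eps -> exists2 eta, 0 < eta &
    forall x, XN x -> W x < eta -> `|Xa x - xt| < eps /\ `|Ua x - ut| < eps.
  move=> e0; have e1 : 0 < eps / cL by rewrite divr_gt0.
  have [eta eta0 he] := growth _ e1.
  exists (eta * (eps / cL)) => [|x Xx We]; first exact: mulr_gt0.
  have ye : `|ya x - yt| < eps / cL.
    rewrite ltNge; apply/negP => ey; have := he x Xx ey.
    by rewrite leNgt (lt_le_trans We)// ler_pM2l.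
  have [h1 h2] := lip x Xx; rewrite ltr_pdivlMr// mulrC in ye.
  by split; [exact: le_lt_trans h1 ye|exact: le_lt_trans h2 ye].
have bd b : exists M, forall x, XN x -> W x <= b -> `|Xa x - xt| <= M.
  have [eta eta0 he] := growth _ ltr01.
  exists (cL * (1 + `|b| / eta)) => x Xx Wb; have [h1 _] := lip x Xx.
  rewrite (le_trans h1)// ler_wpM2l ?(ltW cL0)//.
  have b0 : 0 <= `|b| / eta by rewrite divr_ge0// ltW.
  have [y1|/ltW y1] := leP 1 `|ya x - yt|; last by lra.
  have := he x Xx y1; rewrite mulrC -ler_pdivlMr// => /le_trans h.
  apply: h; apply: ler_wpDl => //; rewrite ler_pM2r ?invr_gt0//.
  exact: le_trans Wb (ler_norm _).
have Xa_eq x : XN x -> Xa x = A *m Xa x + B *m Ua x by move=> /admX[].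
split; first exact: (tracking_stable XN_next W_le dec low up sharp).
move=> x0; exact: (tracking_converges _ _ obs XN_next Xa_eq W_ge0 W_le dec ret sharp bd).
Qed.

End ClosedLoop.

Theorem theorem1 (R : realType) (n m p : nat)
  (A : 'M[R]_n) (B : 'M[R]_(n, m)) (C : 'M[R]_(p, n)) (D : 'M[R]_(p, m))
  (q : nat) (G : 'M[R]_(q, n + m)) (g : 'cV[R]_q)
  (lam : R) (Q Qh : 'M[R]_n) (Rw : 'M[R]_m)
  (VO : 'cV[R]_p -> 'cV[R]_p -> R) (nc N : nat)
  (* lambda in [0,1) *)
  (hlam : 0 <= lam < 1)
  (* Z is a polyhedron (hence closed and convex) with the origin in its interior *)
  (hZint : interior (Zset G g) (0 : 'cV[R]_(n + m)))
  (* the input projection of Z is compact *)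
  (hUcpt : compact [set u : 'cV[R]_m | exists x : 'cV[R]_n, inZ G g x u])
  (* (a) *)
  (hstab : stabilizable A B)
  (* (b) *)
  (hVOconv : convex2 VO)
  (hVOpd : forall y ys, 0 <= VO y ys /\ (VO y ys = 0 <-> y = ys))
  (hVO00 : VO 0 0 = 0)
  (hVOsub : subdiff2 VO)
  (hVOuniq : forall ysp y1 y2,
      is_argmin_VO (Ysp A B C D G g lam) VO ysp y1 ->
      is_argmin_VO (Ysp A B C D G g lam) VO ysp y2 -> y1 = y2)
  (* "the" admissible equilibrium with a given reachable output *)
  (heq_uniq : forall x1 u1 x2 u2,
      adm_eq A B G g lam x1 u1 -> adm_eq A B G g lam x2 u2 ->
      C *m x1 + D *m u1 = C *m x2 + D *m u2 -> x1 = x2 /\ u1 = u2)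
  (* (c) *)
  (hctrb : controllable A B)
  (hnc1 : (1 <= nc)%N)
  (hnc : \rank (ctrb_mx A B nc) = n)
  (hncmin : forall k, (1 <= k < nc)%N -> \rank (ctrb_mx A B k) != n)
  (hR : posdef_mx Rw)
  (hQ : possemidef_mx Q)
  (hQh : Qh^T = Qh /\ possemidef_mx Qh /\ Qh *m Qh = Q)
  (hobs : observable Qh A)
  (* (d) *)
  (hN : (nc <= N)%N)
  (* setpoint and the MPC control law kappa_N(., ysp) *)
  (ysp : 'cV[R]_p) (kappa : 'cV[R]_n -> 'cV[R]_m)
  (hkappa : is_mpc_law A B C D G g lam Q Rw VO N ysp kappa) :
  (* constraint satisfaction *)
  (forall x0, XN A B G g lam N x0 -> forall k,
      inZ G g (cl_traj A B kappa x0 k) (kappa (cl_traj A B kappa x0 k))) /\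
  (* (i) *)
  (Ysp A B C D G g lam ysp ->
    forall xsp usp, adm_eq A B G g lam xsp usp -> C *m xsp + D *m usp = ysp ->
      cl_stable A B kappa (XN A B G g lam N) xsp /\
      forall x0, XN A B G g lam N x0 ->
        cl_converges A B C D kappa x0 xsp usp ysp) /\
  (* (ii) *)
  (~ Ysp A B C D G g lam ysp ->
    exists xt ut, adm_eq A B G g lam xt ut /\
      is_argmin_VO (Ysp A B C D G g lam) VO ysp (C *m xt + D *m ut) /\
      cl_stable A B kappa (XN A B G g lam N) xt /\
      forall x0, XN A B G g lam N x0 ->
        cl_converges A B C D kappa x0 xt ut (C *m xt + D *m ut)).
Proof.
have [Qs [_ QE]] := hQh; rewrite -{}QE in hkappa.
have N0 : (0 < N)%N := leq_trans hnc1 hN.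
have VO0 y ys : 0 <= VO y ys by have [] := hVOpd y ys.
have Xt k x0 : XN A B G g lam N x0 -> XN A B G g lam N (cl_traj A B kappa x0 k).
  move=> X0; elim: k => [//|k IH]; exact: (XN_next hlam hZint N0 hkappa IH).
have target xt ut : adm_eq A B G g lam xt ut ->
    is_argmin_VO (Ysp A B C D G g lam) VO ysp (C *m xt + D *m ut) ->
    cl_stable A B kappa (XN A B G g lam N) xt /\
    forall x0, XN A B G g lam N x0 ->
      cl_converges A B C D kappa x0 xt ut (C *m xt + D *m ut).
  move=> adm amin; have [Yt ymin] := amin.
  apply: (mpc_tracks_target hlam hZint N0 hkappa Qs hobs hR hnc hN hVOconv hVOsub
    VO0 heq_uniq adm ymin).
  move=> y Yy yle; apply: (hVOuniq ysp) => //; split=> // y' Yy'.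
  exact: le_trans yle (ymin _ Yy').
split; [|split].
- move=> x0 X0 k; exact: (kappa_inZ N0 hkappa (Xt k x0 X0)).
- move=> Yy xs us adm yE; have [] := target xs us adm.
    rewrite yE; split=> // y' _.
    by have [_ /iffRL ->] := hVOpd ysp ysp.
  by move=> st cv; split=> // x0 X0; rewrite -yE; exact: cv.
- move=> _.
  have [] := @convex_attains_min _ _ (VO ^~ ysp) (Ysp A B C D G g lam) ysp 0.
  + exact: Ysp_closed.
  + by move=> y; exact: VO0.
  + exact: VO_subdiff1.
  + exact: VO_convex1.
  + exact: Ysp0.
  + move=> y; have [_ /iffRL ->//] := hVOpd ysp ysp => yle.
    have [y0 h] := hVOpd y ysp; apply/h/eqP; by rewrite eq_le yle y0.
  move=> _ [xt [ut [adm ->]]] ymin; exists xt, ut.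
  have amin : is_argmin_VO (Ysp A B C D G g lam) VO ysp (C *m xt + D *m ut).
    by split=> //; exists xt, ut.
  by have [] := target xt ut adm amin.
Qed.
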